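(* Let $p,q\in[1,\infty)$ with $q\neq p$, and let $\mu,\nu\in P_p(\mathbb{R}^d)$ be two probability measures sharing the same copula. For $i=1,\dots,d$, denote by $F_i$ and $G_i$ the distribution functions of the $i$-th one-dimensional margins of $\mu$ and $\nu$, respectively, and let $M(u,v)=\min(u,v)$ be the two-dimensional comonotonicity copula. Then the following holds: 1. If $1\le q\le p<\infty$, then $$\sum_{i=1}^d\int_{\mathbb{R}}\int_{\mathbb{R}}|x_i-y_i|^p\,dM(F_i(x_i),G_i(y_i))\le(W_{p,q}(\mu,\nu))^p\le d^{\frac pq-1}\sum_{i=1}^d\int_{\mathbb{R}}\int_{\mathbb{R}}|x_i-y_i|^p\,dM(F_i(x_i),G_i(y_i)).$$ 2. If $1\le p\le q<\infty$, then $$d^{\frac pq-1}\sum_{i=1}^d\int_{\mathbb{R}}\int_{\mathbb{R}}|x_i-y_i|^p\,dM(F_i(x_i),G_i(y_i))\le(W_{p,q}(\mu,\nu))^p\le\sum_{i=1}^d\int_{\mathbb{R}}\int_{\mathbb{R}}|x_i-y_i|^p\,dM(F_i(x_i),G_i(y_i)).$$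
   Context: For $r\in[1,\infty)$, $\|x\|_r=(\sum_{i=1}^d|x_i|^r)^{1/r}$ on $\mathbb{R}^d$. $P_p(\mathbb{R}^d)$ is the set of Borel probability measures $\mu$ on $\mathbb{R}^d$ with finite moment of order $p$, i.e. $\int_{\mathbb{R}^d}\|x\|^p\,\mu(dx)<\infty$ for one (equivalently, any) norm. A coupling of $\mu$ and $\nu$ is a Borel probability measure $\pi$ on $\mathbb{R}^d\times\mathbb{R}^d$ with $\pi(A\times\mathbb{R}^d)=\mu(A)$ and $\pi(\mathbb{R}^d\times A)=\nu(A)$ for all Borel $A\subseteq\mathbb{R}^d$; $\Pi(\mu,\nu)$ denotes the set of all couplings. The Wasserstein distance $W_{p,q}$ is defined by $$(W_{p,q}(\mu,\nu))^p=\inf_{\pi\in\Pi(\mu,\nu)}\int_{\mathbb{R}^d\times\mathbb{R}^d}\|x-y\|_q^p\,\pi(dx,dy).$$ A $d$-dimensional copula is a function $C:[0,1]^d\to[0,1]$ such that: (1) $C(u)=0$ whenever some $u_i=0$; (2) for all $a,b\in[0,1]^d$ with $a_i\le b_i$ for all $i$, $\sum_{i_1=1}^2\cdots\sum_{i_d=1}^2(-1)^{i_1+\cdots+i_d}C(u_{1i_1},\dots,u_{di_d})\ge0$, where $u_{j1}=a_j$, $u_{j2}=b_j$; (3) $C(1,\dots,1,u_i,1,\dots,1)=u_i$ for all $i$ and all $u_i\in[0,1]$. The joint distribution function of $\mu$ is $H_\mu(x_1,\dots,x_d)=\mu(\prod_{i=1}^d(-\infty,x_i])$. The measures $\mu$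 and $\nu$, with one-dimensional marginal distribution functions $F_1,\dots,F_d$ and $G_1,\dots,G_d$ respectively, share the same copula if there exists a $d$-dimensional copula $C$ such that, for all $x,y\in\mathbb{R}^d$, $H_\mu(x_1,\dots,x_d)=C(F_1(x_1),\dots,F_d(x_d))$ and $H_\nu(y_1,\dots,y_d)=C(G_1(y_1),\dots,G_d(y_d))$. The comonotonicity copula is $M:[0,1]^2\to[0,1]$, $M(u,v)=\min(u,v)$. For distribution functions $F,G$ on $\mathbb{R}$, $(x,y)\mapsto M(F(x),G(y))$ is a joint distribution function on $\mathbb{R}^2$ with margins $F$ and $G$, and $\int_{\mathbb{R}}\int_{\mathbb{R}}g(x,y)\,dM(F(x),G(y))$ denotes the integral of $g$ with respect to the probability measure on $\mathbb{R}^2$ having this distribution function. *)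

(* Defs.v *)
From HB Require Import structures.
From mathcomp Require Export all_boot all_order all_algebra.
From mathcomp Require Export all_classical all_reals all_analysis.

Set Implicit Arguments.
Unset Strict Implicit.
Unset Printing Implicit Defensive.
Import Order.TTheory GRing.Theory Num.Theory.

Local Open Scope classical_set_scope.
Local Open Scope ring_scope.

(* Points of R^d are d-tuples: the library puts on d.-tuple R the sigma-algebra
   generated by the coordinates, which is the Borel sigma-algebra of R^d, and on
   products of measurable types the product sigma-algebra. *)

Definition lnorm (R : realType) (d : nat) (r : R) (x : d.-tuple R) : R :=
  (\sum_(i < d) `|tnth x i| `^ r) `^ r^-1.

Definition tuple_sub (R : realType) (d : nat) (x y : d.-tuple R) : d.-tuple R :=
  [tuple tnth x i - tnth y i | i < d].

(* All the norms of R^d being equivalent, the choice of r is immaterial. *)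
Definition finite_moment (R : realType) (d : nat) (p : R)
    (mu : probability (d.-tuple R) R) : Prop :=
  exists2 r : R, 1 <= r &
    (\int[mu]_x (lnorm r x `^ p)%:E < +oo)%E.

Definition coupling (R : realType) (d : nat)
    (mu nu : probability (d.-tuple R) R) :
    set (probability (d.-tuple R * d.-tuple R)%type R) :=
  [set pi : probability (d.-tuple R * d.-tuple R)%type R |
    forall A : set (d.-tuple R), measurable A ->
    pi (A `*` setT) = mu A /\ pi (setT `*` A) = nu A].

Definition wasserstein (R : realType) (d : nat) (p q : R)
    (mu nu : probability (d.-tuple R) R) : \bar R :=
  (ereal_inf [set \int[pi]_z (lnorm q (tuple_sub z.1 z.2) `^ p)%:E
             | pi in coupling mu nu] `^ p^-1)%E.

Definition unit_cube (R : realType) (d : nat) : set (d.-tuple R) :=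
  [set u | forall i, 0 <= tnth u i <= 1].

(* The index i_j in {1, 2} is (e j).+1 with e j : 'I_2, so that e j = 0 selects
   a_j and e j = 1 selects b_j. *)
Definition box_volume (R : realType) (d : nat) (C : d.-tuple R -> R)
    (a b : d.-tuple R) : R :=
  \sum_(e : {ffun 'I_d -> 'I_2})
    (-1) ^+ (\sum_(j < d) (e j).+1)%N *
    C [tuple if e j == ord0 then tnth a j else tnth b j | j < d].

(* A copula is a function on the unit cube: it is represented by a function on
   R^d about whose values outside of the cube nothing is said. *)
Record is_copula (R : realType) (d : nat) (C : d.-tuple R -> R) : Prop := {
  copula_range : forall u, unit_cube u -> 0 <= C u <= 1 ;
  copula_grounded : forall u, unit_cube u ->
    (exists i, tnth u i = 0) -> C u = 0 ;
  copula_increasing : forall a b, unit_cube a -> unit_cube b ->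
    (forall i, tnth a i <= tnth b i) -> 0 <= box_volume C a b ;
  copula_margins : forall (i : 'I_d) (t : R), 0 <= t <= 1 ->
    C [tuple if j == i then t else 1 | j < d] = t }.

Definition joint_df (R : realType) (d : nat) (mu : probability (d.-tuple R) R)
    (x : d.-tuple R) : R :=
  fine (mu [set z | forall i, tnth z i <= tnth x i]).

Definition margin_df (R : realType) (d : nat) (mu : probability (d.-tuple R) R)
    (i : 'I_d) (t : R) : R :=
  fine (pushforward mu (fun z : d.-tuple R => tnth z i) `]-oo, t]).

Definition share_copula (R : realType) (d : nat)
    (mu nu : probability (d.-tuple R) R) : Prop :=
  exists C : d.-tuple R -> R,
    [/\ is_copula C,
        forall x, joint_df mu x = C [tuple margin_df mu i (tnth x i) | i < d] &
        forall y, joint_df nu y = C [tuple margin_df nu i (tnth y i) | i < d]].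

Definition comonotonicity_copula (R : realType) (u v : R) : R := Num.min u v.

(* The probability measure on R^2 with distribution function M(F(x), G(y)).
   It exists and is unique when F and G are distribution functions; [get]
   returns a default value for other F and G. *)
Definition comonotone_measure (R : realType) (F G : R -> R) :
    probability (R * R)%type R :=
  get [set P : probability (R * R)%type R | forall x y : R,
    P (`]-oo, x] `*` `]-oo, y]) = (comonotonicity_copula (F x) (G y))%:E].

Definition comonotone_cost (R : realType) (d : nat) (p : R)
    (mu nu : probability (d.-tuple R) R) : \bar R :=
  (\sum_(i < d) \int[comonotone_measure (margin_df mu i) (margin_df nu i)]_z
     (`|z.1 - z.2| `^ p)%:E)%E.

(* Main.v *)
(* By comparing the l^p and l^q norms on R^d, everything reduces to the cost
   sum_i |x_i - y_i|^p, for which both bounds have to be shown with constant 1.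
   For p >= 1 the comonotone coupling of two laws on R is optimal: (y - x)_+^p is
   a mixture of indicators 1_(x <= u) 1_(y > v), and the mass of
   {x <= u, y > v} = {x <= u} \ {x <= u, y <= v} is smallest when
   {x <= u} and {y <= v} are nested. Hence the i-th summand of the cost of any
   coupling is at least the i-th comonotone integral.
   All these minima are attained by a single coupling: let V be a random vector
   with distribution function C, the common copula, and apply to V_i the quantile
   functions of the i-th margins of mu and of nu. The vector V is realised on
   [0, 1] with the uniform law: the C-volumes of the dyadic boxes of the unit cube
   are the lengths of a tree of nested intervals, and V(t) is the point common to
   the boxes whose intervals contain t. *)
Require Import Defs.
From mathcomp Require Import ring lra measurable_realfun.

Set Implicit Arguments.
Unset Strict Implicit.
Unset Printing Implicit Defensive.
Import Order.TTheory GRing.Theory Num.Theory.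

Local Open Scope classical_set_scope.
Local Open Scope ring_scope.

(** * Power sums *)

Section PowerSums.
Context {R : realType} {d : nat}.
Implicit Types (x : 'I_d -> R) (a p q : R).

(** Each [x i ^ a] factors as [x i * x i ^ (a - 1)], and the second factor is at most the same power
    of the whole sum because [a - 1 >= 0]. *)
Lemma sum_powR_le a x : 1 <= a -> (forall i, 0 <= x i) ->
  \sum_i x i `^ a <= (\sum_i x i) `^ a.
Proof.
move=> a1 x0; have a0 : 0 < a by apply: lt_le_trans a1.
rewrite -[leRHS]mulr_powRB1 ?sumr_ge0// mulr_suml; apply: ler_sum => i _.
rewrite -mulr_powRB1//; apply: ler_wpM2l => //.
apply: ge0_ler_powR; rewrite ?nnegrE ?subr_ge0 ?sumr_ge0//.
by rewrite (bigD1 i)//= lerDl sumr_ge0.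
Qed.

(* Young's inequality applied to [x i] and [m `^ (a - 1)], where [m] is the
   mean of the [x i]. *)
Lemma powR_sum_le a x : (0 < d)%N -> 1 <= a -> (forall i, 0 <= x i) ->
  (\sum_i x i) `^ a <= d%:R `^ (a - 1) * \sum_i x i `^ a.
Proof.
move=> d0 a1 x0; have a0 : 0 < a by apply: lt_le_trans a1.
have [->|a_neq1] := eqVneq a 1.
  rewrite subrr powRr0 mul1r powRr1 ?sumr_ge0//.
  by under [leRHS]eq_bigr do rewrite powRr1//.
have {a_neq1}a1' : 0 < a - 1 by rewrite subr_gt0 lt_neqAle eq_sym a_neq1.
set S := \sum_i x i; set T := \sum_i x i `^ a.
have S0 : 0 <= S by apply: sumr_ge0.
have D0 : 0 < d%:R :> R by rewrite ltr0n.
pose m := S / d%:R; have m0 : 0 <= m by rewrite divr_ge0// ltW.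
have SE : S = d%:R * m by rewrite /m mulrCA divff ?mulr1// gt_eqF.
have young i : x i * m `^ (a - 1) <= x i `^ a / a + m `^ a * ((a - 1) / a).
  have -> : m `^ a = (m `^ (a - 1)) `^ (a / (a - 1)).
    by rewrite -powRrM mulrCA divff ?mulr1// gt_eqF.
  rewrite -[in _ * (_ / a)](invf_div a); apply: conjugate_powR => //.
  - exact: powR_ge0.
  - by rewrite divr_gt0.
  - by rewrite invf_div -[X in X + _]mul1r -mulrDl addrC subrK divff ?gt_eqF.
have : S * m `^ (a - 1) <= T / a + d%:R * (m `^ a * ((a - 1) / a)).
  rewrite /S /T !mulr_suml (le_trans (ler_sum _ (fun i _ => young i)))//.
  by rewrite big_split/= lerD2l sumr_const card_ord mulr_natl.
rewrite SE -mulrA mulr_powRB1// => yg.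
(* The summed Young inequalities read [d m^a <= T / a + d m^a (a - 1) / a]; the last term is
   absorbed on the left. *)
have {}yg : d%:R * m `^ a <= T.
  have -> : T = a * (T / a) by rewrite mulrCA divff ?mulr1// gt_eqF.
  rewrite -ler_pdivrMl//; rewrite -lerBlDr in yg; apply: le_trans yg.
  rewrite le_eqVlt; apply/orP; left; apply/eqP.
  by field; rewrite gt_eqF.
rewrite powRM// ?(ltW D0)// -(@mulr_powRB1 _ d%:R)// ?(ltW D0)//.
rewrite [_ * d%:R `^ _]mulrC -mulrA; exact: ler_wpM2l.
Qed.

(** The two previous bounds for the exponent [p / q >= 1], applied to the numbers [x i ^ q]. *)
Lemma power_sums_comparison p q x : (0 < d)%N -> 0 < q -> q <= p ->
  (forall i, 0 <= x i) ->
  \sum_i x i `^ p <= (\sum_i x i `^ q) `^ (p / q) /\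
  (\sum_i x i `^ q) `^ (p / q) <= d%:R `^ (p / q - 1) * \sum_i x i `^ p.
Proof.
move=> d0 q0 qp x0.
have pq1 : 1 <= p / q by rewrite ler_pdivlMr ?mul1r.
have xE : \sum_i x i `^ p = \sum_i (x i `^ q) `^ (p / q).
  by apply: eq_bigr => i _; rewrite -powRrM mulrCA divff ?mulr1// gt_eqF.
by rewrite xE; split; [apply: sum_powR_le|apply: powR_sum_le] => // i;
  rewrite powR_ge0.
Qed.

End PowerSums.

(** * Pointwise comparison of powers of the l^q norm with the sum of p-th powers *)

Section LNormPower.
Context {R : realType} {d : nat}.
Implicit Types (z : d.-tuple R) (p q : R).

Lemma lnorm_powR p q z :
  lnorm q z `^ p = (\sum_i `|tnth z i| `^ q) `^ (p / q).
Proof. by rewrite /lnorm -powRrM mulrC. Qed.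

Lemma lnorm_powR_bounds_ge p q z : (0 < d)%N -> 0 < q -> q <= p ->
  \sum_i `|tnth z i| `^ p <= lnorm q z `^ p /\
  lnorm q z `^ p <= d%:R `^ (p / q - 1) * \sum_i `|tnth z i| `^ p.
Proof. by move=> d0 q0 qp; rewrite lnorm_powR; exact: power_sums_comparison. Qed.

(** The comparison of power sums is used with [p] and [q] exchanged, and both inequalities are then
    raised to the power [p / q]; the constant [d^(q/p - 1)] becomes [d^(1 - p/q)] and changes
    sides. *)
Lemma lnorm_powR_bounds_le p q z : (0 < d)%N -> 0 < p -> p <= q ->
  d%:R `^ (p / q - 1) * \sum_i `|tnth z i| `^ p <= lnorm q z `^ p /\
  lnorm q z `^ p <= \sum_i `|tnth z i| `^ p.
Proof.
move=> d0 p0 pq; have q0 : 0 < q by apply: lt_le_trans pq.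
have D0 : 0 < d%:R :> R by rewrite ltr0n.
have [] := @power_sums_comparison _ _ q p (fun i => `|tnth z i|) d0 p0 pq.
  by move=> i; exact: normr_ge0.
rewrite lnorm_powR; set S := \sum_i _ `^ q; set T := \sum_i _ `^ p => ST TS.
have S0 : 0 <= S by apply: sumr_ge0 => i _; exact: powR_ge0.
have T0 : 0 <= T by apply: sumr_ge0 => i _; exact: powR_ge0.
have qpK : q / p * (p / q) = 1.
  by rewrite mulrA divfK ?divff ?gt_eqF.
have TE : (T `^ (q / p)) `^ (p / q) = T by rewrite -powRrM qpK powRr1.
have pq0 : 0 <= p / q by rewrite divr_ge0 ?ltW.
split; last by rewrite -[leRHS]TE ge0_ler_powR ?nnegrE ?powR_ge0.
have : T <= d%:R `^ (1 - p / q) * S `^ (p / q).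
  rewrite -[leLHS]TE (le_trans (ge0_ler_powR pq0 _ _ TS)) ?nnegrE ?powR_ge0//.
    by rewrite mulr_ge0 ?powR_ge0.
  by rewrite powRM ?powR_ge0// -powRrM mulrBl qpK mul1r.
rewrite -(ler_pM2l (powR_gt0 (p / q - 1) D0)) => /le_trans; apply.
rewrite mulrA -powRD; last by rewrite (gt_eqF D0) implybT.
by rewrite addrA subrK subrr powRr0 mul1r.
Qed.

End LNormPower.

(** * Optimality of the comonotone coupling on the line *)

Section PowerAsIntegral.
Import numFieldNormedType.Exports.
Context {R : realType}.
Implicit Types (x y u a p : R).

Lemma is_derive_subr_powR y a u : u < y ->
  is_derive u 1 (fun v => (y - v) `^ a) (- (a * (y - u) `^ (a - 1))).
Proof.
move=> uy; have yu0 : 0 < y - u by rewrite subr_gt0.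
have dsub : is_derive u 1 (fun v => y - v) (-1 : R).
  have -> : (fun v => y - v) = cst y - id by [].
  by apply: is_derive_eq; rewrite sub0r.
have := @is_derive1_comp R (fun v => v `^ a) (fun v => y - v) u _ _
  (is_derive1_powR a yu0) dsub.
by rewrite mulrN1.
Qed.

Lemma subr_powR_cvg_left y a : 0 < a ->
  (y - u) `^ a @[u --> y^'-] --> 0.
Proof.
move=> a0.
apply: (@decreasing_cvg_at_left_comp _ (fun u => y - u) (fun v => v `^ a) -oo%O) => //.
- by move=> u v _ _; rewrite ltrD2l ltrN2.
- by apply: cvgB; [exact: cvg_cst|exact: cvg_at_left_filter].
- by rewrite subrr; exact: powR_cvg0.
Qed.

Lemma derivable_subr_powR x y a : x < y -> 0 < a ->
  derivable_oo_LRcontinuous (fun v => (y - v) `^ a) x y.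
Proof.
move=> xy a0; split.
- move=> u; rewrite in_itv/= => /andP[_ uy].
  by have [] := is_derive_subr_powR a uy.
- apply: cvg_at_right_filter.
  have [dx _] := is_derive_subr_powR a xy.
  exact: (@differentiable_continuous _ _ _ _ _ (proj1 (derivable1_diffP _ _) dx)).
- by rewrite subrr powR0 ?gt_eqF//; exact: subr_powR_cvg_left.
Qed.

(** The derivative of [max(r, 0)^p] away from 0. The test on [r] is explicit because [0^0 = 1],
    which would give a wrong value at [r = 0] when [p = 1]. *)
Definition powR_slope p (r : R) : R := if 0 < r then p * r `^ (p - 1) else 0.

Lemma powR_slope_ge0 p r : 0 <= p -> 0 <= powR_slope p r.
Proof. by move=> p0; rewrite /powR_slope; case: ifP => // _; rewrite mulr_ge0 ?powR_ge0. Qed.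

Lemma powR_slope_homo p : 1 <= p -> {homo powR_slope p : r s / r <= s}.
Proof.
move=> p1 r s rs; rewrite /powR_slope; case: ifPn => r0; last first.
  by apply: powR_slope_ge0; apply: le_trans p1.
have s0 := lt_le_trans r0 rs; rewrite s0 ler_wpM2l ?(le_trans _ p1)//.
by rewrite ge0_ler_powR ?nnegrE ?subr_ge0// ltW.
Qed.

Lemma measurable_powR_slope p : measurable_fun setT (powR_slope p).
Proof.
apply: measurable_fun_if => //; first exact: measurable_fun_ltr.
apply: measurable_funTS; exact: measurable_funM.
Qed.

(** The integrand vanishes outside [[x, y[], where it has the primitive [-(y - u)^p]. This writes
    the power of the positive part as a mixture over thresholds [u]. *)
Lemma integral_powR_slope p x y : 1 <= p ->
  (\int[lebesgue_measure]_u (if (x <= u)%R then powR_slope p (y - u) else 0)%:E =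
   ((Num.max (y - x) 0) `^ p)%:E)%E.
Proof.
move=> p1; have p0 : 0 < p by apply: lt_le_trans p1.
have [yx|xy] := leP y x.
  rewrite (_ : Num.max _ _ = 0) ?powR0 ?gt_eqF//; last first.
    by apply/max_idPr; rewrite subr_le0.
  apply: integral0_eq => u _; case: ifPn => // xu.
  by rewrite /powR_slope ltNge subr_le0 (le_trans yx xu).
rewrite (_ : Num.max _ _ = y - x); last by apply/max_idPl; rewrite subr_ge0 ltW.
transitivity (\int[lebesgue_measure]_(u in `[x, y[) (p * (y - u) `^ (p - 1))%:E)%E.
  rewrite [RHS]integral_mkcond; apply: eq_integral => u _; rewrite patchE.
  rewrite /powR_slope subr_gt0 mem_setE in_itv/=.
  by case: (x <= u) => //=; case: (u < y).
pose f : R -> R := fun u => p * (y - u) `^ (p - 1).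
have cf : {within `[x, y], continuous f}.
  (* For [p = 1] the integrand is constant, even at [u = y]; for [p > 1] its continuity at [y] comes
     from the positive exponent [p - 1]. *)
  rewrite /f; have [->|p_neq1] := eqVneq p 1.
    have -> : (fun u => 1 * (y - u) `^ (1 - 1)) = cst 1.
      by apply/funext => u; rewrite subrr powRr0 mulr1.
    by move=> u; exact: cst_continuous.
  have q0 : 0 < p - 1 by rewrite subr_gt0 lt_neqAle eq_sym p_neq1.
  move=> u; apply: cvgM; first exact: cvg_cst.
  exact: (derivable_oo_LRcontinuous_within (derivable_subr_powR xy q0)).
rewrite integral_itv_bndo_bndc; last first.
  apply: measurable_funTS; apply/measurable_EFinP; apply: measurable_funM => //.
  apply: (measurableT_comp (measurable_powR (p - 1))).
  by apply: measurable_funB.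
rewrite (@continuous_FTC2 _ _ (fun u => - (y - u) `^ p))//; last 2 first.
- have [d1 d2 d3] := derivable_subr_powR xy p0.
  split; [|exact: cvgN|exact: cvgN].
  by move=> u uxy; apply: derivableN; exact: d1.
- move=> u; rewrite in_itv/= => /andP[_ uy].
  have d := is_deriveN (is_derive_subr_powR p uy).
  by rewrite derive1E (@derive_val _ _ _ _ _ _ _ d) opprK.
by rewrite subrr powR0 ?gt_eqF// oppr0 sub0e EFinN oppeK.
Qed.

End PowerAsIntegral.

(** * Comparison of a comonotone pair with any pair having the same margins *)

Section ComonotoneOptimality.
Context {R : realType} (p : R) (p_ge1 : 1 <= p).

Let p_ge0 : 0 <= p. Proof. exact: le_trans p_ge1. Qed.

(** Comonotonicity of [X] and [Y] is expressed below by the nesting of preimages of down-sets, which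
    makes it unnecessary to know whether a half-line is open or closed. *)
Definition downset (D : set R) := forall x y, x <= y -> D y -> D x.

(** The contribution of the threshold [u] to the p-th power of the positive part of [z.2 - z.1]. *)
Let gain u (z : R * R) : R := if z.1 <= u then powR_slope p (z.2 - u) else 0.

Let gain_ge0 u z : 0 <= gain u z.
Proof. by rewrite /gain; case: ifP => // _; exact: powR_slope_ge0. Qed.

Let measurable_gain : measurable_fun [set: R * (R * R)] (fun w => gain w.1 w.2).
Proof.
apply: measurable_fun_if => //.
- apply: measurable_fun_ler => //; exact: measurableT_comp.
- apply: measurable_funTS; apply: measurableT_comp; first exact: measurable_powR_slope.
  by apply: measurable_funB => //; exact: measurableT_comp.
Qed.

Let measurable_gain_pair {dT} {T : measurableType dT} (X Y : T -> R) :
  measurable_fun setT X -> measurable_fun setT Y ->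
  measurable_fun setT (fun w : T * R => (gain w.2 (X w.1, Y w.1))%:E).
Proof.
move=> mX mY; apply/measurable_EFinP.
apply: (measurableT_comp measurable_gain (g := fun w => (w.2, (X w.1, Y w.1)))).
by apply: measurable_fun_pair => //; apply: measurable_fun_pair;
  exact: measurableT_comp.
Qed.

Let pos_part_integral {dT} {T : measurableType dT} (P : probability T R)
    (X Y : T -> R) : measurable_fun setT X -> measurable_fun setT Y ->
  (\int[P]_t ((Num.max (Y t - X t) 0) `^ p)%:E =
   \int[lebesgue_measure]_u \int[P]_t (gain u (X t, Y t))%:E)%E.
Proof.
move=> mX mY.
rewrite -(@fubini_tonelli _ _ _ _ _ P lebesgue_measure
  (fun w => (gain w.2 (X w.1, Y w.1))%:E))/=; last 2 first.
- exact: measurable_gain_pair.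
- by move=> w; rewrite lee_fin.
by apply: eq_integral => t _; rewrite -integral_powR_slope.
Qed.

Let measurable_gain_section {dT} {T : measurableType dT} (X Y : T -> R) u :
  measurable_fun setT X -> measurable_fun setT Y ->
  measurable_fun setT (fun t => gain u (X t, Y t)).
Proof.
move=> mX mY.
apply: (measurableT_comp measurable_gain (g := fun t => (u, (X t, Y t)))).
by apply: measurable_fun_pair => //; exact: measurable_fun_pair.
Qed.

Let low u : set R := [set x | x <= u].
Let slow u s : set R := [set y | powR_slope p (y - u) <= s].

Let measurable_low u : measurable (low u).
Proof. by rewrite /low -set_itvNyc; exact: measurable_itv. Qed.

Let measurable_slow u s : measurable (slow u s).
Proof.
rewrite (_ : slow u s = setT `&`
    (fun y : R => powR_slope p (y - u)) @^-1` `]-oo, s]%classic); last first.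
  by rewrite setTI; apply/seteqP; split=> y; rewrite /slow/= in_itv.
have mf : measurable_fun [set: R] (fun y : R => powR_slope p (y - u)).
  apply: (measurableT_comp (measurable_powR_slope p)).
  by apply: measurable_funB.
by apply: mf => //; exact: measurable_itv.
Qed.

Let gain_tail {dT} {T : measurableType dT} (P : probability T R)
    (X Y : T -> R) u (s : R) :=
  P ((fun t => gain u (X t, Y t)) @^-1` `]s, +oo[%classic).

(** Layer-cake formula: the expectation of a nonnegative variable is the integral of its tail. *)
Let gain_layers {dT} {T : measurableType dT} (P : probability T R)
    (X Y : T -> R) u : measurable_fun setT X -> measurable_fun setT Y ->
  measurable_fun setT (gain_tail P X Y u) /\
  (\int[P]_t (gain u (X t, Y t))%:E =
   \int[lebesgue_measure]_(s in `[0%R, +oo[) gain_tail P X Y u s)%E.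
Proof.
move=> mX mY; have mg := measurable_gain_section u mX mY.
pose G : {RV P >-> R} := mfun_Sub (mem_set mg).
have := @ge0_expectation_ccdf _ _ _ P G.
rewrite expectation.unlock => -> => [|t]; last exact: gain_ge0.
by split => //; exact: (ccdf_measurable G).
Qed.

(** Since [s >= 0], the value 0 taken by [gain] off [low u] never exceeds [s], so the tail event is
    [low u] minus [slow u s]. *)
Let gain_tailE {dT} {T : measurableType dT} (P : probability T R)
    (X Y : T -> R) u s : measurable_fun setT X -> measurable_fun setT Y -> 0 <= s ->
  gain_tail P X Y u s =
  (P (X @^-1` low u) - P (X @^-1` low u `&` Y @^-1` slow u s))%E.
Proof.
move=> mX mY s0.
have mXu : measurable (X @^-1` low u) by rewrite -[_ @^-1` _]setTI; exact: mX.
have mYu : measurable (Y @^-1` slow u s).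
  by rewrite -[_ @^-1` _]setTI; exact: mY.
rewrite -measureD//; last by rewrite (le_lt_trans (probability_le1 _ _)) ?ltry.
congr (P _).
apply/seteqP; split=> t; rewrite /= in_itv/= andbT /gain /low /slow/=.
  by case: ifPn => [? st|_]; [split => //; apply/negP; rewrite -ltNge|rewrite ltNge s0].
by move=> [-> /negP]; rewrite -ltNge.
Qed.

Let measurable_gain_integral {dT} {T : measurableType dT} (P : probability T R)
    (X Y : T -> R) : measurable_fun setT X -> measurable_fun setT Y ->
  measurable_fun setT (fun u => \int[P]_t (gain u (X t, Y t))%:E)%E.
Proof.
move=> mX mY; apply: (measurable_fun_fubini_tonelli_G
  (fun w : T * R => (gain w.2 (X w.1, Y w.1))%:E)).
- exact: measurable_gain_pair.
- by move=> w; rewrite lee_fin.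
Qed.

(** After two layer decompositions only the tails remain to be compared. By equality of the margins
    this amounts to showing that the joint mass of [low u] and [slow u s] is largest for the
    comonotone pair. *)
Lemma comonotone_pos_part_le d1 d2 (T1 : measurableType d1) (T2 : measurableType d2)
    (P1 : probability T1 R) (P2 : probability T2 R)
    (X1 Y1 : T1 -> R) (X2 Y2 : T2 -> R) :
  measurable_fun setT X1 -> measurable_fun setT Y1 ->
  measurable_fun setT X2 -> measurable_fun setT Y2 ->
  (forall A, measurable A -> P1 (X1 @^-1` A) = P2 (X2 @^-1` A)) ->
  (forall A, measurable A -> P1 (Y1 @^-1` A) = P2 (Y2 @^-1` A)) ->
  (forall D E, downset D -> downset E ->
    X2 @^-1` D `<=` Y2 @^-1` E \/ Y2 @^-1` E `<=` X2 @^-1` D) ->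
  (\int[P2]_t ((Num.max (Y2 t - X2 t) 0) `^ p)%:E <=
   \int[P1]_t ((Num.max (Y1 t - X1 t) 0) `^ p)%:E)%E.
Proof.
move=> mX1 mY1 mX2 mY2 XP YP comon.
rewrite !pos_part_integral//; apply: ge0_le_integral => //.
- by move=> u _; apply: integral_ge0 => t _; rewrite lee_fin.
- exact: measurable_gain_integral.
- exact: measurable_gain_integral.
move=> u _; have [mt1 ->] := gain_layers P1 u mX1 mY1.
have [mt2 ->] := gain_layers P2 u mX2 mY2.
apply: ge0_le_integral => //; try exact: measurable_funTS.
move=> s; rewrite /= in_itv/= andbT => s0.
rewrite !gain_tailE// XP//; apply: leeB => //.
have mX := measurable_low u; have mY := measurable_slow u s.
have m1 : measurable (X1 @^-1` low u) by rewrite -[_ @^-1` _]setTI; exact: mX1.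
have m2 : measurable (Y1 @^-1` slow u s) by rewrite -[_ @^-1` _]setTI; exact: mY1.
(* For nested events the intersection is one of the two; its probability is a marginal one, hence
   the same under [P1], where it dominates the intersection. *)
have [||/setIidPl ->|/setIidPr ->] := comon (low u) (slow u s).
- by move=> x y xy; exact: le_trans.
- by move=> x y xy; apply: le_trans; apply: powR_slope_homo => //; rewrite lerD2r.
- by rewrite -XP// le_measure ?inE//; exact: measurableI.
- by rewrite -YP// le_measure ?inE//; exact: measurableI.
Qed.

Lemma normr_powR_split (x y : R) :
  (`|x - y| `^ p)%:E =
  ((Num.max (y - x) 0 `^ p)%:E + (Num.max (x - y) 0 `^ p)%:E)%E.
Proof.
have p0 : p != 0 by rewrite gt_eqF// (lt_le_trans _ p_ge1).
rewrite -EFinD; congr EFin; have [xy|yx] := leP x y.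
  by rewrite ler0_norm ?subr_le0// opprB max_l ?subr_ge0// max_r ?subr_le0// powR0// addr0.
by rewrite gtr0_norm ?subr_gt0// max_r ?subr_le0 ?ltW// max_l ?subr_ge0 ?ltW// powR0// add0r.
Qed.

Lemma measurable_pos_part_powR {dT} {T : measurableType dT} (X Y : T -> R) :
  measurable_fun setT X -> measurable_fun setT Y ->
  measurable_fun setT (fun t => (Num.max (Y t - X t) 0 `^ p)%:E).
Proof.
move=> mX mY; apply/measurable_EFinP.
apply: (measurableT_comp (measurable_powR p)).
by apply: measurable_maxr => //; exact: measurable_funB.
Qed.

(** The absolute value is split into the two positive parts; the comonotonicity hypothesis is
    symmetric, so the second part is treated by exchanging the variables. *)
Lemma comonotone_optimal d1 d2 (T1 : measurableType d1) (T2 : measurableType d2)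
    (P1 : probability T1 R) (P2 : probability T2 R)
    (X1 Y1 : T1 -> R) (X2 Y2 : T2 -> R) :
  measurable_fun setT X1 -> measurable_fun setT Y1 ->
  measurable_fun setT X2 -> measurable_fun setT Y2 ->
  (forall A, measurable A -> P1 (X1 @^-1` A) = P2 (X2 @^-1` A)) ->
  (forall A, measurable A -> P1 (Y1 @^-1` A) = P2 (Y2 @^-1` A)) ->
  (forall D E, downset D -> downset E ->
    X2 @^-1` D `<=` Y2 @^-1` E \/ Y2 @^-1` E `<=` X2 @^-1` D) ->
  (\int[P2]_t (`|X2 t - Y2 t| `^ p)%:E <= \int[P1]_t (`|X1 t - Y1 t| `^ p)%:E)%E.
Proof.
move=> mX1 mY1 mX2 mY2 XP YP comon.
under eq_integral do rewrite normr_powR_split.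
under [leRHS]eq_integral do rewrite normr_powR_split.
rewrite !ge0_integralD//; try exact: measurable_pos_part_powR;
  try by move=> t _; rewrite lee_fin powR_ge0.
apply: leeD; apply: comonotone_pos_part_le => // D E dD dE.
by have [] := comon E D dE dD; [right|left].
Qed.

End ComonotoneOptimality.

(** * A random vector distributed according to a copula *)

Section BoxVolume.
Context {R : realType} {d : nat}.
Implicit Types (C : d.-tuple R -> R) (a b g : d.-tuple R) (i j : 'I_d).

Definition upd a i (c : R) : d.-tuple R :=
  [tuple if j == i then c else tnth a j | j < d].

Lemma tnth_upd a i c j : tnth (upd a i c) j = if j == i then c else tnth a j.
Proof. by rewrite tnth_mktuple. Qed.

Lemma upd_id a i : upd a i (tnth a i) = a.
Proof. by apply: eq_from_tnth => j; rewrite tnth_upd; case: eqP => // ->. Qed.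

Lemma unit_cube_upd a i c : unit_cube a -> 0 <= c <= 1 -> unit_cube (upd a i c).
Proof. by move=> a01 c01 j; rewrite tnth_upd; case: ifP. Qed.

(** A sign-reversing involution of the index set of [box_volume]. *)
Definition flip (i : 'I_d) (e : {ffun 'I_d -> 'I_2}) : {ffun 'I_d -> 'I_2} :=
  [ffun j => if j == i then rev_ord (e j) else e j].

Lemma flipK i : involutive (flip i).
Proof.
by move=> e; apply/ffunP => j; rewrite !ffunE; case: eqP => // _; exact: rev_ordK.
Qed.

Lemma flip_eq0 i e : (flip i e i == ord0) = (e i != ord0).
Proof. by rewrite ffunE eqxx; case: (e i) => -[|[|]]. Qed.

Lemma sign_flip i e :
  (-1) ^+ (\sum_(j < d) (flip i e j).+1)%N =
  - (-1) ^+ (\sum_(j < d) (e j).+1)%N :> R.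
Proof.
rewrite (bigD1 i)//= [in RHS](bigD1 i)//= !exprD !ffunE eqxx.
under eq_bigr => j ji do rewrite ffunE (negbTE ji).
by rewrite -mulNr; congr (_ * _); case: (e i) => -[|[|[]]]//= ?; rewrite !exprS !expr0; ring.
Qed.

(** Vertices with [i]-th coordinate [a_i] or [b_i] occur on both sides with the same sign. Those of
    the two pieces with [i]-th coordinate [c] cancel in pairs under [flip i]. *)
Lemma box_volume_split C a b i c :
  box_volume C a b = box_volume C a (upd b i c) + box_volume C (upd a i c) b.
Proof.
apply/eqP; rewrite -subr_eq0 opprD addrA -!sumrB.
pose pick (e : {ffun 'I_d -> 'I_2}) a b :=
  [tuple if e j == ord0 then tnth a j else tnth b j | j < d].
pose s (e : {ffun 'I_d -> 'I_2}) : R := (-1) ^+ (\sum_(j < d) (e j).+1)%N.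
rewrite (bigID (fun e : {ffun 'I_d -> 'I_2} => e i == ord0))/=.
rewrite (eq_bigr (fun e => - (s e * C (pick e (upd a i c) b)))); last first.
  move=> e ei0; rewrite -!/(s e).
  rewrite (_ : [tuple _ | _ < _] = pick e a b)//.
  rewrite (_ : [tuple _ | _ < _] = pick e a b) ?subrr ?sub0r//.
  apply: eq_from_tnth => j; rewrite !tnth_mktuple.
  by case: ifPn => // ej; case: eqP => // ji; rewrite -ji (negbTE ej) in ei0.
rewrite [X in _ + X](eq_bigr (fun e => - (s e * C (pick e a (upd b i c))))); last first.
  move=> e ei0; rewrite -!/(s e).
  rewrite (_ : [tuple _ | _ < _] = pick e a b)//.
  rewrite [X in _ - X](_ : _ = s e * C (pick e a b)) 1?addrAC ?subrr ?sub0r//.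
  congr (_ * C _); apply: eq_from_tnth => j; rewrite !tnth_mktuple.
  by case: ifPn => // ej; case: eqP => // ji; rewrite -ji ej in ei0.
rewrite [X in _ + X](reindex_inj (inv_inj (flipK i)))/=.
under [X in _ + X]eq_bigl do rewrite flip_eq0 negbK.
rewrite -big_split/= big1// => e ei0.
rewrite /s sign_flip mulNr opprK addrC; apply/eqP; rewrite subr_eq0; apply/eqP.
congr (_ * C _); apply: eq_from_tnth => j; rewrite !tnth_mktuple ffunE.
by have [->|ji] := eqVneq j i; rewrite ?ei0//; case: (e i) ei0 => -[|[|]].
Qed.

(** Cutting at the common value shows that the volume is twice itself. *)
Lemma box_volume_degenerate C a b i : tnth a i = tnth b i -> box_volume C a b = 0.
Proof.
move=> ab; have := box_volume_split C a b i (tnth a i).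
by rewrite upd_id ab upd_id => /esym/eqP; rewrite -subr_eq0 addrK => /eqP.
Qed.

(** Groundedness kills every vertex but [g], whose sign is [(-1)^(2d) = 1]. *)
Lemma box_volume_origin C g : is_copula C -> unit_cube g ->
  box_volume C [tuple 0 | _ < d] g = C g.
Proof.
move=> cC g01; rewrite /box_volume.
rewrite (bigD1 [ffun=> ord_max])//= [X in _ + X]big1 ?addr0; last first.
  move=> e e1; rewrite (copula_grounded cC) ?mulr0//.
    by move=> j; rewrite tnth_mktuple; case: ifP => // _; rewrite tnth_mktuple lexx ler01.
  have [j ej0] : exists j, e j != ord_max.
    apply/existsP; rewrite -negb_forall; apply: contra e1 => /forallP e1.
    by apply/eqP/ffunP => j; rewrite ffunE; exact/eqP.
  exists j; rewrite tnth_mktuple ifT ?tnth_mktuple//.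
  by case: (e j) ej0 => -[|[|]].
under eq_bigr do rewrite ffunE.
rewrite sum_nat_const card_ord mulnC exprM sqrrN expr1n expr1n mul1r.
by congr C; apply: eq_from_tnth => j; rewrite !tnth_mktuple ffunE.
Qed.

Lemma box_volume_le C a b g : is_copula C ->
  unit_cube a -> unit_cube b -> unit_cube g ->
  (forall i, tnth a i <= tnth g i) -> (forall i, tnth g i <= tnth b i) ->
  box_volume C a g <= box_volume C a b.
Proof.
move=> cC a01 b01 g01 ag gb.
(* The coordinates of [b] are lowered to those of [g] one at a time, those in [r] being done; each
   step cuts off a box of nonnegative volume. *)
pose h (r : seq 'I_d) := [tuple if j \in r then tnth g j else tnth b j | j < d].
have h01 r : unit_cube (h r) by move=> j; rewrite tnth_mktuple; case: ifP.
have ah r j : tnth a j <= tnth (h r) j.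
  by rewrite tnth_mktuple; case: ifP => // _; exact: le_trans (gb j).
have -> : g = h (enum 'I_d).
  by apply: eq_from_tnth => j; rewrite tnth_mktuple mem_enum.
elim: (enum 'I_d) => [|i r IH].
  by rewrite (_ : h [::] = b)//; apply: eq_from_tnth => j; rewrite tnth_mktuple.
apply: le_trans IH; rewrite (box_volume_split C a (h r) i (tnth g i)).
have -> : h (i :: r) = upd (h r) i (tnth g i).
  apply: eq_from_tnth => j; rewrite tnth_upd !tnth_mktuple in_cons.
  by case: eqP => // ->.
rewrite lerDl (copula_increasing cC)//; first exact: unit_cube_upd.
move=> j; rewrite tnth_upd; case: eqP => // ->.
by rewrite tnth_mktuple; case: ifP.
Qed.

End BoxVolume.

(** * Binary trees of nested intervals and the path of a point *)

Lemma probability_setI_full {R : realType} {dT} {T : measurableType dT}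
    (P : probability T R) (A B : set T) :
  measurable A -> measurable B -> P A = 1%E -> P (A `&` B) = P B.
Proof.
move=> mA mB PA1.
have PAc : P (~` A) = 0 by rewrite probability_setC// PA1 subee.
have PBAc : P (B `&` ~` A) = 0.
  by apply: (subset_measure0 _ _ _ PAc) => //; [apply: measurableI => //|]; exact: measurableC.
have -> : P B = (P (B `&` A) + P (B `&` ~` A))%E.
  rewrite -measureU//; last 3 first.
  - exact: measurableI.
  - by apply: measurableI => //; exact: measurableC.
  - by rewrite setIACA setICr setI0.
  by rewrite -setIUr setUv setIT.
by rewrite PBAc adde0 setIC.
Qed.

(* Nodes of the binary tree are represented by lists of bits, the deepest bit
   first. *)
Section BinaryTree.
Context {R : realType} (P : probability R R).
Hypothesis P_uniform : forall x y : R, 0 <= x -> x <= y -> y <= 1 ->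
  P `[x, y[%classic = (y - x)%:E.
Context (w : seq bool -> R).
Hypothesis w_ge0 : forall s, 0 <= w s.
Hypothesis w_split : forall s, w s = w (false :: s) + w (true :: s).
Hypothesis w_nil : w [::] = 1.

(** Left end of the interval of a node: the interval of the [false] child comes first, and that of
    the [true] child follows it. *)
Fixpoint tree_lo (s : seq bool) : R :=
  if s is c :: s' then tree_lo s' + (if c then w (false :: s') else 0) else 0.

Definition tree_cell (s : seq bool) : set R :=
  `[tree_lo s, tree_lo s + w s[%classic.

Fixpoint tree_node (n : nat) (t : R) : seq bool :=
  if n is m.+1 then
    (tree_lo (true :: tree_node m t) <= t) :: tree_node m t
  else [::].

Lemma size_tree_node n t : size (tree_node n t) = n.
Proof. by elim: n => //= n ->. Qed.

Lemma tree_cell_bounds s : 0 <= tree_lo s /\ tree_lo s + w s <= 1.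
Proof.
elim: s => [|c s [IH0 IH1]]/=; first by rewrite w_nil add0r.
have := w_split s; have := w_ge0 (false :: s); have := w_ge0 (true :: s).
by case: c => ? ? ?; split; lra.
Qed.

Lemma P_tree_cell s : P (tree_cell s) = (w s)%:E.
Proof.
have [lo0 hi1] := tree_cell_bounds s.
by rewrite /tree_cell P_uniform ?lerDl// addrAC subrr add0r.
Qed.

Lemma measurable_tree_cell s : measurable (tree_cell s).
Proof. exact: measurable_itv. Qed.

Lemma tree_cell_split s :
  tree_cell s = tree_cell (false :: s) `|` tree_cell (true :: s).
Proof.
have := w_split s; have := w_ge0 (false :: s); have := w_ge0 (true :: s).
move=> wt wf ws; apply/seteqP; split=> t; rewrite /tree_cell/= !in_itv/=.
  move=> /andP[? ?]; have [?|?] := ltP t (tree_lo s + w (false :: s)).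
    by left; apply/andP; split; lra.
  by right; apply/andP; split; lra.
by case=> /andP[? ?]; apply/andP; split; lra.
Qed.

Lemma tree_cell_disjoint s :
  tree_cell (false :: s) `&` tree_cell (true :: s) = set0.
Proof.
apply/seteqP; split=> // t; rewrite /tree_cell/= !in_itv/= addr0.
by move=> [/andP[_ ?] /andP[? _]]; lra.
Qed.

Lemma tree_node_cell s t : tree_cell s t -> tree_node (size s) t = s.
Proof.
elim: s => //= c s IH tcs.
have /IH -> : tree_cell s t by rewrite tree_cell_split; case: c tcs => ?; [right|left].
congr (_ :: _); move: tcs; rewrite /tree_cell/= in_itv/=.
by case: c => /= /andP[? ?]; [lra|apply/negbTE; rewrite -ltNge; lra].
Qed.

(** By induction on the depth: there are countably many nodes, and once the parent is fixed the next
    bit is decided by a half-line. *)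
Lemma measurable_tree_node n (A : set (seq bool)) :
  measurable [set t | A (tree_node n t)].
Proof.
elim: n A => [A|n IH A].
  have [A0|A0] := pselect (A [::]).
    by rewrite (_ : [set t | _] = setT)//; apply/seteqP; split.
  by rewrite (_ : [set t | _] = set0)//; apply/seteqP; split.
pose B (c : bool) s := [set t : R | (tree_lo (true :: s) <= t) = c].
have mB c s : measurable (B c s).
  case: c.
    rewrite (_ : B _ _ = `[tree_lo (true :: s), +oo[%classic)//.
    by apply/seteqP; split=> t; rewrite /B/= in_itv/= andbT.
  rewrite (_ : B _ _ = `]-oo, tree_lo (true :: s)[%classic)//.
  apply/seteqP; split=> t; rewrite /B/= in_itv/= ltNge; first by move=> ->.
  by move=> /negbTE.
rewrite (_ : [set t | _] = \bigcup_(s : seq bool)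
    ([set t | tree_node n t = s /\ A (true :: s)] `&` B true s `|`
     [set t | tree_node n t = s /\ A (false :: s)] `&` B false s)).
  apply: countable_bigcupT_measurable => // s.
  apply: measurableU; apply: measurableI => //.
    exact: (IH [set s' | s' = s /\ A (true :: s)]).
  exact: (IH [set s' | s' = s /\ A (false :: s)]).
apply/seteqP; split=> t /=.
  move=> At; exists (tree_node n t) => //; rewrite /B/=.
  by case: (_ <= t) At => At; [left|right].
by move=> [s _ [[[/= <- As]]|[[/= <- As]]]]; rewrite /B/= => ->.
Qed.

(** By additivity [v [::]] is the sum of [v] over the nodes of depth [n]: those in [A] have [v] at
    least the length of their interval, and the others contribute nonnegatively. *)
Lemma tree_node_le (A : set (seq bool)) (v : seq bool -> R) n :
  (forall s, v s = v (false :: s) + v (true :: s)) ->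
  (forall s, size s = n -> 0 <= v s) ->
  (forall s, size s = n -> A s -> w s <= v s) ->
  (P [set t | A (tree_node n t)] <= (v [::])%:E)%E.
Proof.
move=> v_split v_ge0 wv.
have mA := measurable_tree_node n A.
rewrite -(@probability_setI_full _ _ _ P (tree_cell [::]))//; last first.
- by rewrite P_tree_cell w_nil.
- exact: measurable_tree_cell.
(* Generalised to [n = k + size s]: the claim is proved inside the cell of any node [s], by
   induction on the number [k] of levels left below it. *)
have : (n = n + @size bool [::])%N by rewrite addn0.
elim: {2}n [::] => [|k IH] s ns.
  have [As|As] := pselect (A s).
    apply: (@le_trans _ _ (P (tree_cell s))).
      apply: le_measure; rewrite ?inE; last exact: subIsetl.
        by apply: measurableI => //; exact: measurable_tree_cell.
      exact: measurable_tree_cell.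
    by rewrite P_tree_cell lee_fin wv.
  rewrite (_ : _ `&` _ = set0) ?measure0 ?lee_fin ?v_ge0//.
  apply/seteqP; split=> // t [/tree_node_cell]; rewrite -[size s]add0n -ns.
  by move=> /= ->.
rewrite tree_cell_split setIUl measureU//; last 3 first.
- by apply: measurableI => //; exact: measurable_tree_cell.
- by apply: measurableI => //; exact: measurable_tree_cell.
- by rewrite setIACA tree_cell_disjoint set0I.
by rewrite v_split EFinD leeD// IH//= addnS.
Qed.

(** The reverse bound: nodes of depth [n] outside [A] now contribute at most 0 to [v [::]]. *)
Lemma tree_node_ge (A : set (seq bool)) (v : seq bool -> R) n :
  (forall s, v s = v (false :: s) + v (true :: s)) ->
  (forall s, size s = n -> A s -> v s <= w s) ->
  (forall s, size s = n -> ~ A s -> v s <= 0) ->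
  ((v [::])%:E <= P [set t | A (tree_node n t)])%E.
Proof.
move=> v_split vw v_le0.
have mA := measurable_tree_node n A.
rewrite -(@probability_setI_full _ _ _ P (tree_cell [::]))//; last first.
- by rewrite P_tree_cell w_nil.
- exact: measurable_tree_cell.
have : (n = n + @size bool [::])%N by rewrite addn0.
elim: {2}n [::] => [|k IH] s ns.
  have [As|As] := pselect (A s).
    rewrite (_ : _ `&` _ = tree_cell s) ?P_tree_cell ?lee_fin ?vw//.
    apply/seteqP; split=> t; first by case.
    by move=> ts; split => //=; rewrite ns add0n tree_node_cell.
  by rewrite (@le_trans _ _ 0%E)// lee_fin v_le0.
rewrite tree_cell_split setIUl measureU//; last 3 first.
- by apply: measurableI => //; exact: measurable_tree_cell.
- by apply: measurableI => //; exact: measurable_tree_cell.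
- by rewrite setIACA tree_cell_disjoint set0I.
by rewrite v_split EFinD leeD// IH//= addnS.
Qed.

End BinaryTree.

(** The sets with preimage in [S] form a sigma-algebra, and the open upper rays generate the Borel
    sets. [S] is kept abstract so as to cover generated sigma-algebras too. *)
Lemma sigma_algebra_preimage_itvNyc {R : realType} {T : Type} (S : set (set T))
    (f : T -> R) : sigma_algebra setT S ->
  (forall x, S [set t | f t <= x]) -> forall A, measurable A -> S (f @^-1` A).
Proof.
move=> sS Sf A mA; have sI := sigma_algebra_image f sS.
have {mA} := eq_ind _ (fun B => B A) mA _ (RGenOInfty.measurableE R).
rewrite -(setTI (f @^-1` A)).
apply: (@smallest_sub _ (sigma_algebra setT) _ (image_set_system setT f S)) => //.
move=> _ [x ->]; rewrite /image_set_system/= setTI.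
rewrite (_ : _ @^-1` _ = setT `\` [set t | f t <= x]); first by case: sS => _ + _; exact.
apply/seteqP; split=> t; rewrite /= in_itv/= andbT ltNge; first by move/negP.
by move=> [_ ?]; apply/negP.
Qed.

Lemma measurable_fun_itvNyc {R : realType} {dT} {T : measurableType dT} (f : T -> R) :
  (forall x, measurable [set t | f t <= x]) -> measurable_fun setT f.
Proof.
move=> mf _ A mA; rewrite setTI; apply: sigma_algebra_preimage_itvNyc => //.
exact: sigma_algebra_measurable.
Qed.

Section NullSets.
Context {R : realType} {dT} {T : measurableType dT} (P : probability T R).
Implicit Types A B N : set T.

Lemma probability_bigcup_ord_eq0 n (N : 'I_n -> set T) :
  (forall i, measurable (N i)) -> (forall i, P (N i) = 0) ->
  measurable (\bigcup_i N i) /\ P (\bigcup_i N i) = 0.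
Proof.
move=> mN N0.
have -> : \bigcup_i N i = \big[setU/set0]_(i < n) N i.
  rewrite -bigcup_seq; congr bigcup; apply/seteqP.
  by split=> i //= _; rewrite mem_index_enum.
elim/big_ind : _ => [|A B [mA A0] [mB B0]|i _]; [by []| |by []].
by split; [exact: measurableU|apply: null_set_setU].
Qed.

Lemma probability_le_null A B N : measurable A -> measurable B -> measurable N ->
  P N = 0 -> A `<=` B `|` N -> (P A <= P B)%E.
Proof.
move=> mA mB mN N0 AB; apply: (@le_trans _ _ (P (B `|` N))).
  by apply: le_measure; rewrite ?inE//; exact: measurableU.
apply: (le_trans (measureU2 P mB mN)).
by change (P B + P N <= P B)%E; rewrite N0 adde0.
Qed.

End NullSets.

(* The tree cuts the unit cube in half along the coordinate directions in turn. *)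
Section DyadicBoxes.
Context {R : realType} {d : nat} (d_gt0 : (0 < d)%N).
Implicit Types (s : seq bool) (i : 'I_d) (g : d.-tuple R).

Definition cut_dir n : 'I_d := Ordinal (ltn_pmod n d_gt0).

Fixpoint dyadic_box s : d.-tuple R * d.-tuple R :=
  if s is c :: s' then
    let: (a, b) := dyadic_box s' in
    let i := cut_dir (size s') in
    let m := (tnth a i + tnth b i) / 2 in
    if c then (upd a i m, b) else (a, upd b i m)
  else ([tuple 0 | _ < d], [tuple 1 | _ < d]).

Lemma dyadic_box_le s i :
  0 <= tnth (dyadic_box s).1 i /\
  tnth (dyadic_box s).1 i <= tnth (dyadic_box s).2 i /\
  tnth (dyadic_box s).2 i <= 1.
Proof.
elim: s => [|c s IH]/=; first by rewrite !tnth_mktuple; split; [|split]; lra.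
by case: (dyadic_box s) c IH => a b [] /= [? [? ?]]; rewrite tnth_upd;
  case: eqP => // ij; subst i; split; [|split| |split]; lra.
Qed.

Lemma unit_cube_dyadic_box s :
  unit_cube (dyadic_box s).1 /\ unit_cube (dyadic_box s).2.
Proof. by split=> i; have [? [? ?]] := dyadic_box_le s i; apply/andP; split; lra. Qed.

Lemma dyadic_box_nested c s i :
  tnth (dyadic_box s).1 i <= tnth (dyadic_box (c :: s)).1 i /\
  tnth (dyadic_box (c :: s)).2 i <= tnth (dyadic_box s).2 i.
Proof.
have [_ []] := dyadic_box_le s i; rewrite /=.
by case: (dyadic_box s) c => a b [] /= ? ?; rewrite tnth_upd; case: eqP => ij //;
  subst i; split => //; lra.
Qed.

(** The side lengths of a box depend on its depth only, see [dyadic_box_width]. *)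
Fixpoint dyadic_width n i : R :=
  if n is m.+1 then
    if i == cut_dir m then dyadic_width m i / 2 else dyadic_width m i
  else 1.

Lemma dyadic_box_width s i :
  tnth (dyadic_box s).2 i - tnth (dyadic_box s).1 i = dyadic_width (size s) i.
Proof.
elim: s => [|c s]/=; first by rewrite !tnth_mktuple subr0.
by case: (dyadic_box s) c => a b [] /= <-; rewrite tnth_upd; case: eqP => // ->; lra.
Qed.

Lemma dyadic_width_ge0 n i : 0 <= dyadic_width n i.
Proof. by elim: n => //= n ?; case: ifP => // _; lra. Qed.

Lemma dyadic_width_homo n k i : dyadic_width (n + k) i <= dyadic_width n i.
Proof.
elim: k => [|k IH]; first by rewrite addn0.
have := dyadic_width_ge0 (n + k) i.
by rewrite addnS/=; case: ifP => // _ ?; lra.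
Qed.

Lemma dyadic_width_round m i : dyadic_width (m * d) i <= (2 ^+ m)^-1.
Proof.
elim: m => [|m IH]; first by rewrite mul0n expr0 invr1.
have id := ltn_ord i.
(* In round [m] the direction [i] is cut at depth [m * d + i]; the remaining [d - i.+1] cuts of the
   round do not increase the width. *)
have -> : (m.+1 * d = (m * d + i).+1 + (d - i.+1))%N.
  by rewrite -addnS -addnA subnKC// mulSn addnC.
apply: le_trans (dyadic_width_homo _ _ _) _.
rewrite /= ifT; last by apply/eqP/val_inj; rewrite /= modnMDl modn_small.
rewrite exprS invfM mulrC ler_wpM2l//.
exact: le_trans (dyadic_width_homo _ _ _) IH.
Qed.

Lemma dyadic_width_small (e : R) i : 0 < e -> exists n, dyadic_width n i < e.
Proof.
move=> e0; exists (Num.bound e^-1 * d)%N.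
apply: le_lt_trans (dyadic_width_round _ _) _.
have e'0 : 0 < e^-1 by rewrite invr_gt0.
rewrite invf_plt ?posrE ?exprn_gt0//.
apply: (lt_le_trans (archi_boundP (ltW e'0))).
by rewrite -natrX ler_nat ltnW// ltn_expl.
Qed.

End DyadicBoxes.

(** * The point common to the nested boxes and its distribution function *)

Section CopulaVector.
Context {R : realType} {d : nat} (d_gt0 : (0 < d)%N).
Context (P : probability R R).
Hypothesis P_uniform : forall x y : R, 0 <= x -> x <= y -> y <= 1 ->
  P `[x, y[%classic = (y - x)%:E.
Context (C : d.-tuple R -> R).
Hypothesis cC : is_copula C.
Implicit Types (s : seq bool) (i : 'I_d) (g : d.-tuple R).

Let dbox : seq bool -> d.-tuple R * d.-tuple R := dyadic_box d_gt0.
Let box_le := @dyadic_box_le R d d_gt0.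
Let box_cube := @unit_cube_dyadic_box R d d_gt0.
Let box_nested := @dyadic_box_nested R d d_gt0.

Let clip g (a : d.-tuple R) : d.-tuple R :=
  [tuple Num.min (tnth a i) (tnth g i) | i < d].

(* Like [mass] below, [clipped g] is additive along the tree, but its value at
   the root is [C g]: this sandwiches [C g] between the probabilities that the
   upper, resp. the lower, corner of the current box is below [g]. *)
Let clipped g s := box_volume C (clip g (dbox s).1) (clip g (dbox s).2).

Let clip_upd g a i c : clip g (upd a i c) = upd (clip g a) i (Num.min c (tnth g i)).
Proof.
by apply: eq_from_tnth => j; rewrite !(tnth_mktuple, tnth_upd); case: eqP => // ->.
Qed.

Let clipped_split g s :
  clipped g s = clipped g (false :: s) + clipped g (true :: s).
Proof.
rewrite /clipped /dbox /=; case: (dyadic_box d_gt0 s) => a b /=.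
by rewrite !clip_upd; exact: box_volume_split.
Qed.

Let clip_id g a : (forall i, tnth a i <= tnth g i) -> clip g a = a.
Proof.
by move=> ag; apply: eq_from_tnth => i; rewrite tnth_mktuple; apply/min_idPl.
Qed.

Let unit_cube_clip g a : unit_cube g -> unit_cube a -> unit_cube (clip g a).
Proof.
move=> g01 a01 i; rewrite tnth_mktuple.
by have := g01 i; have := a01 i; rewrite /Num.min; case: ifP.
Qed.

Let mass s := box_volume C (dbox s).1 (dbox s).2.

(** Clipping at the top corner of the cube changes nothing, so [mass] inherits the additivity and
    the root value of [clipped]. *)
Let massE s : mass s = clipped [tuple 1 | _ < d] s.
Proof.
rewrite /clipped !clip_id// => i; rewrite tnth_mktuple.
  by have [_ []] := box_le s i.
by have [_ [ab b1]] := box_le s i; exact: le_trans ab b1.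
Qed.

Let mass_split s : mass s = mass (false :: s) + mass (true :: s).
Proof. by rewrite !massE. Qed.

Let mass_ge0 s : 0 <= mass s.
Proof.
have [? ?] := box_cube s.
by apply: (copula_increasing cC) => // i; have [_ []] := box_le s i.
Qed.

Let clipped_nil g : unit_cube g -> clipped g [::] = C g.
Proof.
move=> g01; rewrite -(box_volume_origin cC g01); congr box_volume;
  apply: eq_from_tnth => i; rewrite !tnth_mktuple; have /andP[? ?] := g01 i.
- exact/min_idPl.
- exact/min_idPr.
Qed.

Let unit_cube1 : @unit_cube R d [tuple 1 | _ < d].
Proof. by move=> i; rewrite tnth_mktuple ler01 lexx. Qed.

Let mass_nil : mass [::] = 1.
Proof.
rewrite massE clipped_nil//.
rewrite -[RHS](@copula_margins _ _ _ cC (cut_dir d_gt0 0))//; last first.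
  by rewrite ler01 lexx.
by congr C; apply: eq_from_tnth => i; rewrite !tnth_mktuple; case: ifP.
Qed.

Let nd n t := tree_node mass n t.
Let lo n t : d.-tuple R := (dbox (nd n t)).1.
Let hi n t : d.-tuple R := (dbox (nd n t)).2.

Let measurable_nd n (A : set (seq bool)) : measurable [set t | A (nd n t)].
Proof. exact: measurable_tree_node. Qed.

(** On boxes lying below [g] clipping does nothing and [clipped g] equals [mass]; elsewhere it is
    nonnegative. *)
Let P_hi_le g n : unit_cube g ->
  (P [set t | forall i, (tnth (hi n t) i <= tnth g i)%R] <= (C g)%:E)%E.
Proof.
move=> g01; rewrite -(clipped_nil g01).
apply: (@tree_node_le _ _ P_uniform _ mass_ge0 mass_split mass_nil
  [set s | forall i, tnth (dbox s).2 i <= tnth g i]) => // [s _|s _ /= sg].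
- have [? ?] := box_cube s.
  apply: (copula_increasing cC); try exact: unit_cube_clip.
  move=> i; rewrite !tnth_mktuple; have [_ [? _]] := box_le s i.
  by rewrite le_min2.
- rewrite /clipped !clip_id// => i; apply: le_trans (sg i).
  by have [_ []] := box_le s i.
Qed.

(** If the lower corner is strictly below [g], the clipped box is part of the box; otherwise it is
    degenerate and has volume 0. *)
Let P_lo_lt g n : unit_cube g ->
  ((C g)%:E <= P [set t | forall i, (tnth (lo n t) i < tnth g i)%R])%E.
Proof.
move=> g01; rewrite -(clipped_nil g01).
apply: (@tree_node_ge _ _ P_uniform _ mass_ge0 mass_split mass_nil
  [set s | forall i, tnth (dbox s).1 i < tnth g i]) => // [s _ /= sg|s _ /= sg].
- have [? ?] := box_cube s.
  rewrite /clipped (clip_id (fun i => ltW (sg i))).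
  apply: box_volume_le => //; first exact: unit_cube_clip.
    move=> i; rewrite tnth_mktuple le_min (ltW (sg i)) andbT.
    by have [_ []] := box_le s i.
  by move=> i; rewrite tnth_mktuple ge_min lexx.
- have /existsNP[i /negP] := sg; rewrite -leNgt => gs.
  rewrite /clipped (box_volume_degenerate _ (i := i))// !tnth_mktuple.
  have [_ [? _]] := box_le s i.
  by rewrite !(min_idPr _) //; apply: le_trans gs _.
Qed.

Let lo_homo i t : {homo (fun n => tnth (lo n t) i) : m n / (m <= n)%N >-> m <= n}.
Proof.
apply: homo_leq => // [x y z|n]; first exact: le_trans.
by have [] := box_nested (tree_lo mass (true :: nd n t) <= t) (nd n t) i.
Qed.

Let hi_homo i t : {homo (fun n => tnth (hi n t) i) : m n / (m <= n)%N >-> n <= m}.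
Proof.
apply: (homo_leq (r := fun x y => y <= x)) => // [x y z /[swap]|n]; first exact: le_trans.
by have [] := box_nested (tree_lo mass (true :: nd n t) <= t) (nd n t) i.
Qed.

Let lo_le_hi i t m n : tnth (lo m t) i <= tnth (hi n t) i.
Proof.
apply: le_trans (lo_homo i t (leq_maxl m n)) _.
apply: le_trans _ (hi_homo i t (leq_maxr m n)).
by have [_ []] := box_le (nd (maxn m n) t) i.
Qed.

(** The lower corners along the path of [t] increase and stay below all the upper ones, so the
    supremum is a coordinate of a point common to the boxes. *)
Let U i t : R := sup (range (fun n => tnth (lo n t) i)).

Let lo_le_U i t n : tnth (lo n t) i <= U i t.
Proof.
apply: ub_le_sup; last by exists n.
by exists (tnth (hi 0 t) i) => _ [m _ <-]; exact: lo_le_hi.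
Qed.

Let U_leP i t x : U i t <= x <-> forall n, tnth (lo n t) i <= x.
Proof.
split=> [Ux n|lox]; first exact: le_trans (lo_le_U i t n) Ux.
apply: ge_sup; first by exists (tnth (lo 0 t) i); exists 0%N.
by move=> _ [n _ <-].
Qed.

Let U_le_hi i t n : U i t <= tnth (hi n t) i.
Proof. by apply/U_leP => m; exact: lo_le_hi. Qed.

Let measurable_lo_le i n x : measurable [set t | tnth (lo n t) i <= x].
Proof. exact: (measurable_nd n [set s | tnth (dbox s).1 i <= x]). Qed.

Let measurable_U_le i x : measurable [set t | U i t <= x].
Proof.
rewrite (_ : [set t | _] = \bigcap_n [set t | tnth (lo n t) i <= x]).
  by apply: bigcapT_measurable => n.
by apply/seteqP; split=> t /= => [/U_leP|] h; [move=> n _|apply/U_leP => n]; exact: h.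
Qed.

Let measurable_U i : measurable_fun setT (U i).
Proof. exact: measurable_fun_itvNyc. Qed.

Let measurable_coordinatewise (Q : 'I_d -> set R) :
  (forall i, measurable (Q i)) -> measurable [set t | forall i, Q i (U i t)].
Proof.
move=> mQ; rewrite (_ : [set t | _] = \bigcap_(i : 'I_d) (U i @^-1` Q i)).
  apply: fin_bigcap_measurable => // i _.
  by rewrite -[_ @^-1` _]setTI; exact: measurable_U.
by apply/seteqP; split=> t /= h i; [move=> _|]; exact: h.
Qed.

Let measurable_U_le_all g : measurable [set t | forall i, U i t <= tnth g i].
Proof.
apply: (measurable_coordinatewise (Q := fun i => [set x | x <= tnth g i])) => i.
by rewrite -set_itvNyc; exact: measurable_itv.
Qed.

(** The lower bound [P_lo_lt] passes to the limit along decreasing events; strict inequalities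
    become weak in the limit. *)
Let C_le_P g : unit_cube g ->
  ((C g)%:E <= P [set t | forall i, (U i t <= tnth g i)%R])%E.
Proof.
move=> g01.
pose F n := [set t | forall i, tnth (lo n t) i < tnth g i].
have mF n : measurable (F n).
  exact: (measurable_nd n [set s | forall i, tnth (dbox s).1 i < tnth g i]).
have mF' : measurable (\bigcap_n F n) by exact: bigcapT_measurable.
have F_noninc : nonincreasing_seq F.
  move=> m n mn; apply/subsetPset => t Ft i.
  exact: le_lt_trans (lo_homo i t mn) (Ft i).
have PF0 : (P (F 0%N) < +oo)%E.
  by rewrite (le_lt_trans (probability_le1 P (mF 0%N)))// ltry.
have := nonincreasing_cvg_mu PF0 mF mF' F_noninc.
move=> /(@cvge_to_ge _ _ _ _ _ (C g)%:E) CF.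
apply: (le_trans (CF _)); first by apply: nearW => n; exact: P_lo_lt.
apply: le_measure; rewrite ?inE//.
by move=> t Ft i; apply/U_leP => n; exact/ltW/Ft.
Qed.

Let measurable_lt_or1 g :
  measurable [set t | forall i, U i t < tnth g i \/ tnth g i = 1].
Proof.
apply: (measurable_coordinatewise (Q := fun i => [set x | x < tnth g i \/ tnth g i = 1])) => i.
have [g1|g1] := pselect (tnth g i = 1).
  rewrite (_ : [set x | _] = setT)//; apply/seteqP.
  by split=> // x _; right.
rewrite (_ : [set x | _] = `]-oo, tnth g i[%classic); first exact: measurable_itv.
by apply/seteqP; split=> x; rewrite /= in_itv/=; [case|left].
Qed.

(** The box widths tend to 0, so [U i t < tnth g i] forces the upper corner below [tnth g i] at some
    depth; where [tnth g i = 1] depth 0 suffices. The bound [P_hi_le] then passes to the limit along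
    increasing events. *)
Let P_le_C g : unit_cube g ->
  (P [set t | forall i, (U i t < tnth g i)%R \/ tnth g i = 1%R] <= (C g)%:E)%E.
Proof.
move=> g01.
pose F n := [set t | forall i, tnth (hi n t) i <= tnth g i].
have mF n : measurable (F n).
  exact: (measurable_nd n [set s | forall i, tnth (dbox s).2 i <= tnth g i]).
have mF' : measurable (\bigcup_n F n) by exact: bigcupT_measurable.
have F_nondec : nondecreasing_seq F.
  move=> m n mn; apply/subsetPset => t Ft i.
  exact: le_trans (hi_homo i t mn) (Ft i).
have := nondecreasing_cvg_mu (mu := P) mF mF' F_nondec.
move=> /(@cvge_to_le _ _ _ _ _ (C g)%:E) FC.
apply: (le_trans _ (FC _)); last by apply: nearW => n; exact: P_hi_le.
apply: le_measure; rewrite ?inE//.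
move=> t Ut.
have N i : {n | tnth (hi n t) i <= tnth g i}.
  apply: cid; have [Ug|->] := Ut i; last first.
    by exists 0%N; have [_ []] := box_le (nd 0 t) i.
  have gU : 0 < tnth g i - U i t by rewrite subr_gt0.
  have [n wn] := dyadic_width_small d_gt0 i gU; exists n.
  have := dyadic_box_width d_gt0 (nd n t) i.
  rewrite size_tree_node => wE; have := lo_le_U i t n.
  by rewrite /hi/lo; move: wn; rewrite -wE /dbox => wn ?; lra.
exists (\max_i sval (N i)) => // i.
apply: le_trans (hi_homo i t (leq_bigmax i)) _.
exact: svalP (N i).
Qed.

Let U_ge0 i t : 0 <= U i t.
Proof.
by apply: le_trans (lo_le_U i t 0); have [] := box_le (nd 0 t) i.
Qed.

Let U_le1 i t : U i t <= 1.
Proof.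
by apply: le_trans (U_le_hi i t 0) _; have [_ []] := box_le (nd 0 t) i.
Qed.

Let margin_point i (x : R) : d.-tuple R := [tuple if j == i then x else 1 | j < d].

Let unit_cube_margin i x : 0 <= x <= 1 -> unit_cube (margin_point i x).
Proof. by move=> x01 j; rewrite tnth_mktuple; case: ifP => // _; rewrite ler01 lexx. Qed.

Let measurable_U_lt i x : measurable [set t | U i t < x].
Proof.
rewrite (_ : [set t | _] = setT `&` U i @^-1` `]-oo, x[%classic).
  by apply: measurable_U => //; exact: measurable_itv.
by rewrite setTI; apply/seteqP; split=> t; rewrite /= in_itv.
Qed.

Let measurable_U_eq i x : measurable [set t | U i t = x].
Proof.
rewrite (_ : [set t | _] = setT `&` U i @^-1` [set x]).
  by apply: measurable_U => //; exact: measurable_set1.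
by rewrite setTI.
Qed.

(** Negative [x] are allowed here, as are [x > 1] in the next bound, so that both apply to the
    perturbed points [x - e / 2] and [x + e / 2] of [P_U_eq]. *)
Let P_U_le i x : x <= 1 -> (x%:E <= P [set t | (U i t <= x)%R])%E.
Proof.
move=> x1; have [x0|x0] := leP 0 x; last first.
  by apply: (@le_trans _ _ 0%E); rewrite ?lee_fin ?(ltW x0).
have x01 : 0 <= x <= 1 by rewrite x0.
rewrite -{1}(copula_margins cC i x01).
apply: le_trans (C_le_P (unit_cube_margin i x01)) _.
apply: le_measure; rewrite ?inE//.
by move=> t /= /(_ i); rewrite tnth_mktuple eqxx.
Qed.

Let P_U_lt i x : 0 <= x -> (P [set t | (U i t < x)%R] <= x%:E)%E.
Proof.
move=> x0; have [x1|x1] := leP x 1; last first.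
  apply: le_trans (probability_le1 _ _) _ => //.
  by rewrite lee_fin ltW.
have x01 : 0 <= x <= 1 by rewrite x0.
rewrite -{2}(copula_margins cC i x01).
apply: le_trans _ (P_le_C (unit_cube_margin i x01)).
apply: le_measure; rewrite ?inE//.
by move=> t /= Ux j; rewrite !tnth_mktuple; case: eqP => [->|_]; [left|right].
Qed.

Let P_U_eq i x : 0 <= x -> x <= 1 -> P [set t | U i t = x] = 0.
Proof.
move=> x0 x1; apply/eqP; rewrite eq_le measure_ge0 andbT.
apply/lee_addgt0Pr => e e0; rewrite add0e.
have e20 : 0 < e / 2 by rewrite divr_gt0.
have U1 := @P_U_le i (x - e / 2); have U2 := @P_U_lt i (x + e / 2).
have {U1}U1 : ((x - e / 2)%:E <= P [set t | (U i t <= x - e / 2)%R])%E.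
  by apply: U1; lra.
have {U2}U2 : (P [set t | (U i t < x + e / 2)%R] <= (x + e / 2)%:E)%E.
  by apply: U2; lra.
have U3 : (P [set t | U i t = x] + P [set t | (U i t <= x - e / 2)%R]
    <= P [set t | (U i t < x + e / 2)%R])%E.
  rewrite -measureU//; last first.
    by apply/seteqP; split=> // t [/= -> ?]; lra.
  apply: le_measure; rewrite ?inE//; first exact: measurableU.
  by move=> t /= [->|?]; lra.
rewrite -(leeD2rE _ _ (_ : (x - e / 2)%:E \is a fin_num))//.
apply: le_trans (leeD2l _ U1) _; apply: le_trans U3 _; apply: le_trans U2 _.
by rewrite -EFinD lee_fin; lra.
Qed.

(** The weak and strict events of the two bounds differ only on the null sets where some [U i t]
    equals [tnth g i]. *)
Let P_U g : unit_cube g -> P [set t | forall i, U i t <= tnth g i] = (C g)%:E.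
Proof.
move=> g01; apply/eqP; rewrite eq_le C_le_P// andbT.
have [] := @probability_bigcup_ord_eq0 _ _ _ P _
    (fun i => [set t | U i t = tnth g i]) _ _.
- by move=> i; exact: measurable_U_eq.
- by move=> i; have /andP[? ?] := g01 i; exact: P_U_eq.
move=> mN N0; apply: le_trans (P_le_C g01).
apply: (probability_le_null _ _ mN N0) => // t /= Ug.
have [Ut|/existsNP[i Ut]] := pselect (forall i, U i t < tnth g i).
  by left=> i; left.
right; exists i => //=; apply/eqP; rewrite eq_le Ug/= leNgt; exact/negP.
Qed.

Lemma copula_vector : exists V : R -> d.-tuple R,
  [/\ measurable_fun setT V,
      forall t i, 0 < tnth (V t) i < 1 &
      forall g, unit_cube g ->
        P [set t | forall i, tnth (V t) i <= tnth g i] = (C g)%:E].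
Proof.
(* The values 0 and 1, where a quantile may be infinite, are replaced by an arbitrary interior
   value; this changes [U] on a null set only. *)
pose V t := [tuple if 0 < U i t < 1 then U i t else 2^-1 | i < d].
have V01 t i : 0 < tnth (V t) i < 1.
  by rewrite tnth_mktuple; case: ifP => // _; apply/andP; split; lra.
have mV : measurable_fun setT V.
  apply/measurable_fun_tnthP => i; rewrite (_ : _ \o _ = fun t =>
    if 0 < U i t < 1 then U i t else 2^-1); last first.
    by apply/funext => t /=; rewrite tnth_mktuple.
  apply: measurable_fun_if => //.
  - by apply: measurable_and; exact: measurable_fun_ltr.
  - exact: measurable_funTS.
exists V; split => // g g01; rewrite -P_U//.
have [] := @probability_bigcup_ord_eq0 _ _ _ P _
    (fun i => [set t | U i t = 0] `|` [set t | U i t = 1]) _ _.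
- by move=> i; apply: measurableU; exact: measurable_U_eq.
- by move=> i; apply: null_set_setU => //; exact: P_U_eq.
set N := \bigcup_i _ => mN N0.
have VU t : ~ N t -> forall i, tnth (V t) i = U i t.
  move=> Nt i; rewrite tnth_mktuple ifT//.
  rewrite !lt_neqAle U_ge0 U_le1 !andbT eq_sym.
  by apply/andP; split; apply/eqP => Ui; apply: Nt; exists i => //; [left|right].
have mV' : measurable [set t | forall i, tnth (V t) i <= tnth g i].
  rewrite (_ : [set t | _] = \bigcap_(i : 'I_d)
      ((fun t => tnth (V t) i) @^-1` `]-oo, tnth g i])).
    apply: fin_bigcap_measurable => // i _; rewrite -[_ @^-1` _]setTI.
    by move/measurable_fun_tnthP : mV => /(_ i); apply => //; exact: measurable_itv.
  apply/seteqP; split=> t /= h i; first by move=> _; rewrite /= in_itv/=; exact: h.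
  by have := h i I; rewrite /= in_itv.
apply/eqP; rewrite eq_le; apply/andP; split; apply: (probability_le_null _ _ mN N0) => //.
- move=> t /= Vg; have [Nt|Nt] := pselect (N t); [by right|left=> i].
  by rewrite -VU.
- move=> t /= Ug; have [Nt|Nt] := pselect (N t); [by right|left=> i].
  by rewrite VU.
Qed.

End CopulaVector.

(** * Coupling through the common copula *)

Section Quantile.
Import numFieldNormedType.Exports.
Context {R : realType} {dT} {T : measurableType dT} {P : probability T R}.
Context (X : {RV P >-> R}).
Implicit Types u x : R.

Definition quantile u : R := inf [set x | (u%:E <= cdf X x)%E].

(** The limits 1 and 0 of the distribution function make the set under the infimum nonempty and
    bounded below for [0 < u < 1]; right continuity shows that the infimum belongs to it. *)
Lemma quantile_le u x : 0 < u -> u < 1 ->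
  quantile u <= x <-> (u%:E <= cdf X x)%E.
Proof.
move=> u0 u1; pose S := [set x | (u%:E <= cdf X x)%E].
have S0 : S !=set0.
  apply/set0P; apply/negP => /eqP S0.
  have : (1 <= u%:E :> \bar R)%E.
    apply: (cvge_to_le (cvg_cdfy1 X)); apply: nearW => y.
    have /negP : ~ S y by rewrite S0.
    by rewrite -ltNge => /ltW.
  by rewrite lee_fin leNgt u1.
have Slb : has_lbound S.
  apply: contrapT => Slb; have : (u%:E <= 0 :> \bar R)%E.
    apply: (cvge_to_ge (cvg_cdfNy0 X)); apply: nearW => y.
    apply: contrapT => /negP; rewrite -ltNge => yu; apply: Slb.
    exists y => z; rewrite /S/= => uz; rewrite leNgt; apply/negP => /ltW zy.
    by have := lt_le_trans yu (le_trans uz (cdf_nondecreasing X zy)); rewrite ltxx.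
  by rewrite lee_fin leNgt u0.
split=> [qx|ux]; last exact: ge_inf.
apply: (@le_trans _ _ (cdf X (quantile u))); last exact: cdf_nondecreasing.
apply: (cvge_to_ge (@cdf_right_continuous _ _ _ P X (quantile u))).
near=> y.
have qy : quantile u < y by near: y; exact: nbhs_right_gt.
have [z Sz zy] := inf_lt S0 qy.
exact: le_trans Sz (cdf_nondecreasing X (ltW zy)).
Unshelve. end_near. Qed.

Lemma quantile_homo u v : 0 < u -> u <= v -> v < 1 -> quantile u <= quantile v.
Proof.
move=> u0 uv v1; rewrite quantile_le//; last exact: le_lt_trans v1.
apply: (@le_trans _ _ v%:E); first by rewrite lee_fin.
by rewrite -quantile_le//; exact: lt_le_trans uv.
Qed.

End Quantile.

(** * Laws are determined by their distribution functions *)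

Section OrthantUniqueness.
Context {R : realType}.

Section Tuple.
Context {d : nat}.
Implicit Types (x : d.-tuple R).

Definition orthant x : set (d.-tuple R) := [set z | forall i, tnth z i <= tnth x i].

Lemma measurable_orthant x : measurable (orthant x).
Proof.
rewrite (_ : orthant x = \bigcap_(i : 'I_d)
    ((fun z => tnth z i) @^-1` `]-oo, tnth x i])).
  apply: fin_bigcap_measurable => // i _; rewrite -[_ @^-1` _]setTI.
  by apply: measurable_tnth => //; exact: measurable_itv.
apply/seteqP; split=> t /= h i; first by move=> _; rewrite /= in_itv/=; exact: h.
by have := h i I; rewrite /= in_itv.
Qed.

(** A half-space [z_i <= x] is the countable union over [n] of the orthants whose other bounds are
    [n]. *)
Lemma measurable_tuple_orthant :
  @measurable _ (d.-tuple R) = <<s range orthant >>.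
Proof.
apply/seteqP; split; last first.
  apply: smallest_sub; first exact: sigma_algebra_measurable.
  by move=> _ [x _ <-]; exact: measurable_orthant.
apply: (@smallest_sub _ (sigma_algebra setT)); first exact: smallest_sigma_algebra.
rewrite -bigcup_seq; apply: bigcup_sub => i _ _ [A mA <-].
rewrite setTI; apply: sigma_algebra_preimage_itvNyc A mA => [|x].
  exact: smallest_sigma_algebra.
rewrite (_ : [set t | _] =
  \bigcup_n orthant [tuple if j == i then x else n%:R | j < d]).
  apply: sigma_algebra_bigcup => n; apply: sub_sigma_algebra.
  by exists [tuple if j == i then x else n%:R | j < d].
apply/seteqP; split=> z /=; last first.
  by move=> [n _ /(_ i)]; rewrite tnth_mktuple eqxx.
move=> zx; exists (Num.bound (\sum_j `|tnth z j|)) => // j.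
rewrite tnth_mktuple; case: eqP => [->//|_].
apply: le_trans (ltW (archi_boundP _)); last by apply: sumr_ge0.
by apply: le_trans (ler_norm _) _; rewrite (bigD1 j)//= lerDl sumr_ge0.
Qed.

(** Orthants generate the sigma-algebra, are stable under intersection and exhaust the space, so the
    pi-system uniqueness theorem applies. *)
Lemma orthant_measure_unique (m1 m2 : probability (d.-tuple R) R) :
  (forall x, m1 (orthant x) = m2 (orthant x)) ->
  forall A, measurable A -> m1 A = m2 A.
Proof.
move=> m12; apply: (measure_unique (range orthant)
  (fun n => orthant [tuple n%:R | _ < d])).
- exact: measurable_tuple_orthant.
- move=> _ _ [x _ <-] [y _ <-].
  exists [tuple Num.min (tnth x i) (tnth y i) | i < d] => //.
  apply/seteqP; split=> z /=.
    by move=> zxy; split=> i; have := zxy i; rewrite tnth_mktuple le_min => /andP[].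
  by move=> [zx zy] i; rewrite tnth_mktuple le_min zx zy.
- by move=> n; exists [tuple n%:R | _ < d].
- apply/seteqP; split=> // z _; exists (Num.bound (\sum_j `|tnth z j|)) => // j.
  rewrite tnth_mktuple; apply: le_trans (ltW (archi_boundP _)); last by apply: sumr_ge0.
  by apply: le_trans (ler_norm _) _; rewrite (bigD1 j)//= lerDl sumr_ge0.
- by move=> _ [x _ <-]; exact: m12.
- by move=> n; rewrite (le_lt_trans (probability_le1 _ _)) ?ltry//; exact: measurable_orthant.
Qed.

End Tuple.

(** The analogue of [orthant] on the product type on which [comonotone_measure] lives. *)
Definition quadrant (x : R * R) : set (R * R) := `]-oo, x.1] `*` `]-oo, x.2].

Lemma measurable_prod_quadrant :
  @measurable _ (R * R)%type = <<s range quadrant >>.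
Proof.
have quadrantP x z : quadrant x z <-> z.1 <= x.1 /\ z.2 <= x.2.
  by rewrite /quadrant/= !in_itv.
apply/seteqP; split; last first.
  apply: smallest_sub; first exact: sigma_algebra_measurable.
  by move=> _ [x _ <-]; apply: measurableX; exact: measurable_itv.
apply: (@smallest_sub _ (sigma_algebra setT)); first exact: smallest_sigma_algebra.
rewrite subUset; split=> _ [A mA <-].
- rewrite setTI; apply: sigma_algebra_preimage_itvNyc A mA => [|x].
    exact: smallest_sigma_algebra.
  rewrite (_ : [set t | _] = \bigcup_n quadrant (x, n%:R)).
    apply: sigma_algebra_bigcup => n; apply: sub_sigma_algebra.
    by exists (x, n%:R).
  apply/seteqP; split=> z; last by move=> [n _ /quadrantP[]].
  move=> zx; exists (Num.bound `|z.2|) => //; apply/quadrantP; split => //=.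
  exact: le_trans (ler_norm _) (ltW (archi_boundP _)).
- rewrite setTI; apply: sigma_algebra_preimage_itvNyc A mA => [|x].
    exact: smallest_sigma_algebra.
  rewrite (_ : [set t | _] = \bigcup_n quadrant (n%:R, x)).
    apply: sigma_algebra_bigcup => n; apply: sub_sigma_algebra.
    by exists (n%:R, x).
  apply/seteqP; split=> z; last by move=> [n _ /quadrantP[]].
  move=> zx; exists (Num.bound `|z.1|) => //; apply/quadrantP; split => //=.
  exact: le_trans (ler_norm _) (ltW (archi_boundP _)).
Qed.

Lemma quadrant_measure_unique (m1 m2 : probability (R * R)%type R) :
  (forall x, m1 (quadrant x) = m2 (quadrant x)) ->
  forall A, measurable A -> m1 A = m2 A.
Proof.
have quadrantP x z : quadrant x z <-> z.1 <= x.1 /\ z.2 <= x.2.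
  by rewrite /quadrant/= !in_itv.
move=> m12; apply: (measure_unique (range quadrant)
  (fun n => quadrant (n%:R, n%:R))).
- exact: measurable_prod_quadrant.
- move=> _ _ [x _ <-] [y _ <-].
  exists (Num.min x.1 y.1, Num.min x.2 y.2) => //.
  apply/seteqP; split=> z.
    move=> /quadrantP/=; rewrite !le_min => -[/andP[? ?] /andP[? ?]].
    by split; apply/quadrantP.
  by move=> [/quadrantP[? ?] /quadrantP[? ?]]; apply/quadrantP; rewrite /= !le_min; split; apply/andP.
- by move=> n; exists (n%:R, n%:R).
- apply/seteqP; split=> // z _; exists (Num.bound (`|z.1| + `|z.2|)) => //.
  apply/quadrantP; have := archi_boundP (addr_ge0 (normr_ge0 z.1) (normr_ge0 z.2)).
  have := ler_norm z.1; have := ler_norm z.2.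
  have := normr_ge0 z.1; have := normr_ge0 z.2.
  by move=> /= ? ? ? ? ?; split; lra.
- by move=> _ [x _ <-]; exact: m12.
- move=> n; rewrite (le_lt_trans (probability_le1 _ _)) ?ltry//.
  by apply: measurableX; exact: measurable_itv.
Qed.

End OrthantUniqueness.

(* The pushforward along the identity is there because [uniform_prob] is a
   measure on [measurableTypeR R], whose display is not the one of [R]. *)
Lemma exists_uniform_probability (R : realType) :
  exists P : probability R R, forall x y : R, 0 <= x -> x <= y -> y <= 1 ->
    P `[x, y[%classic = (y - x)%:E.
Proof.
have mid : @measurable_fun _ _ (measurableTypeR R) R setT id.
  by move=> _ A mA; rewrite setTI.
pose I : {mfun measurableTypeR R >-> R} := @mfun_Sub _ _ (measurableTypeR R) R id (mem_set mid).
exists (distribution (uniform_prob (@ltr01 R)) I) => x y x0 xy y1.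
transitivity (\int[lebesgue_measure]_(t in `[x, y[) (uniform_pdf 0 1 t)%:E)%E.
  by [].
rewrite (eq_integral (fun=> 1%E)); last first.
  move=> t; rewrite inE/= in_itv/= => /andP[xt ty].
  rewrite /uniform_pdf (le_trans x0 xt)/= (ltW (lt_le_trans ty y1))/=.
  by rewrite subr0 invr1.
rewrite integral_cst//= mul1e.
rewrite lebesgue_measure_itv/= lte_fin.
by case: ltgtP xy => // -> _; rewrite subrr.
Qed.

(** * Quantile transforms of a vector distributed according to the copula *)

Section CopulaCoupling.
Context {R : realType} {d : nat}.
Implicit Types (mu nu : probability (d.-tuple R) R) (i : 'I_d).

Definition margin_rv mu i : {RV mu >-> R} :=
  mfun_Sub (mem_set (@measurable_tnth _ R d i)).

Lemma margin_dfE mu i x : (margin_df mu i x)%:E = cdf (margin_rv mu i) x.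
Proof.
rewrite /margin_df -[pushforward _ _ _]/(cdf (margin_rv mu i) x) fineK//.
by apply: fin_num_measure; exact: measurable_itv.
Qed.

Section QuantileVector.
Context (mu : probability (d.-tuple R) R) (V : R -> d.-tuple R).
Hypothesis mV : measurable_fun setT V.
Hypothesis V01 : forall t i, 0 < tnth (V t) i < 1.

Definition quantile_vector t : d.-tuple R :=
  [tuple quantile (margin_rv mu i) (tnth (V t) i) | i < d].

Lemma quantile_vector_le t i x :
  tnth (quantile_vector t) i <= x <-> tnth (V t) i <= margin_df mu i x.
Proof.
have /andP[V0 V1] := V01 t i.
by rewrite tnth_mktuple quantile_le// -margin_dfE lee_fin.
Qed.

Lemma measurable_quantile_vector : measurable_fun setT quantile_vector.
Proof.
apply/measurable_fun_tnthP => i; apply: measurable_fun_itvNyc => x.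
rewrite (_ : [set t | _] = [set t | tnth (V t) i <= margin_df mu i x]).
  rewrite -[X in measurable X]setTI; apply: measurable_fun_le => //.
  by move/measurable_fun_tnthP : mV; exact.
by apply/seteqP; split=> t /quantile_vector_le.
Qed.

Lemma quantile_vector_homo i t t' : tnth (V t) i <= tnth (V t') i ->
  tnth (quantile_vector t) i <= tnth (quantile_vector t') i.
Proof.
move=> tt'; rewrite !tnth_mktuple; have /andP[t0 _] := V01 t i.
by have /andP[_ t1] := V01 t' i; exact: quantile_homo.
Qed.

End QuantileVector.

Context (P : probability R R) (C : d.-tuple R -> R).
Hypothesis cC : is_copula C.
Context (V : R -> d.-tuple R).
Hypothesis mV : measurable_fun setT V.
Hypothesis V01 : forall t i, 0 < tnth (V t) i < 1.
Hypothesis P_V : forall g, unit_cube g ->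
  P [set t | forall i, tnth (V t) i <= tnth g i] = (C g)%:E.

Lemma margin_df_itv01 mu i x : 0 <= margin_df mu i x <= 1.
Proof. by rewrite -!lee_fin margin_dfE cdf_ge0 cdf_le1. Qed.

(** By the Galois property of quantiles, the transform lies in the orthant at [x] exactly when [V]
    lies below the marginal values at [x]; this has probability [C] of these values, that is
    [joint_df mu x]. *)
Lemma quantile_vector_distribution mu :
  (forall x, joint_df mu x = C [tuple margin_df mu i (tnth x i) | i < d]) ->
  forall A, measurable A -> P (quantile_vector mu V @^-1` A) = mu A.
Proof.
move=> muC A mA.
pose X : {mfun R >-> d.-tuple R} :=
  mfun_Sub (mem_set (measurable_quantile_vector mu mV V01)).
apply: (orthant_measure_unique (m1 := distribution P X) (m2 := mu)) => // x.
rewrite -[RHS]fineK ?fin_num_measure//; last exact: measurable_orthant.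
rewrite -[fine _]/(joint_df mu x) muC -P_V.
  rewrite /distribution /pushforward; congr (P _); apply/seteqP; split=> t h i.
    by rewrite tnth_mktuple; apply/quantile_vector_le => //; exact: h.
  by apply/quantile_vector_le => //; have := h i; rewrite tnth_mktuple.
by move=> i; rewrite tnth_mktuple; exact: margin_df_itv01.
Qed.

Lemma P_margin i x : 0 <= x <= 1 -> P [set t | tnth (V t) i <= x] = x%:E.
Proof.
move=> x01; rewrite -[in RHS](copula_margins cC i x01) -P_V.
  congr (P _); apply/seteqP; split=> t /=.
    move=> Vx j; rewrite tnth_mktuple; case: eqP => [->//|_].
    by have /andP[_ /ltW] := V01 t j.
  by move=> /(_ i); rewrite tnth_mktuple eqxx.
by move=> j; rewrite tnth_mktuple; case: ifP => // _; rewrite ler01 lexx.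
Qed.

Section Coupling.
Context (mu nu : probability (d.-tuple R) R).
Hypothesis muC :
  forall x, joint_df mu x = C [tuple margin_df mu i (tnth x i) | i < d].
Hypothesis nuC :
  forall x, joint_df nu x = C [tuple margin_df nu i (tnth x i) | i < d].

Let X := quantile_vector mu V.
Let Y := quantile_vector nu V.
Let mX : measurable_fun setT X := measurable_quantile_vector mu mV V01.
Let mY : measurable_fun setT Y := measurable_quantile_vector nu mV V01.
Let mXi i : measurable_fun setT (fun t => tnth (X t) i).
Proof. by move/measurable_fun_tnthP : mX; exact. Qed.
Let mYi i : measurable_fun setT (fun t => tnth (Y t) i).
Proof. by move/measurable_fun_tnthP : mY; exact. Qed.

(** Both coordinates are quantiles of the same uniform [V_i], so their joint distribution function
    is the probability that [V_i] is below both marginal values, that is their minimum. *)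
Lemma comonotone_measureE i A : measurable A ->
  comonotone_measure (margin_df mu i) (margin_df nu i) A =
  P ((fun t => (tnth (X t) i, tnth (Y t) i)) @^-1` A).
Proof.
move=> mA.
pose Z : {mfun R >-> (R * R)%type} :=
  mfun_Sub (mem_set (measurable_fun_pair (mXi i) (mYi i))).
have ZP x y : distribution P Z (`]-oo, x] `*` `]-oo, y]) =
    (comonotonicity_copula (margin_df mu i x) (margin_df nu i y))%:E.
  rewrite /comonotonicity_copula -(@P_margin i); last first.
    by rewrite le_min ge_min; have /andP[-> ->] := margin_df_itv01 mu i x;
       have /andP[-> _] := margin_df_itv01 nu i y.
  rewrite /distribution /pushforward; congr (P _); apply/seteqP.
  split=> t; rewrite /= !in_itv/= le_min.
    by move=> [/quantile_vector_le -> // /quantile_vector_le ->].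
  by move=> /andP[? ?]; split; apply/quantile_vector_le.
(* The law of [Z] is a witness, so [get] does not return its default value; uniqueness on quadrants
   then identifies the two measures. *)
have M := @getPex _ [set Q : probability (R * R)%type R | forall x y : R,
   Q (`]-oo, x] `*` `]-oo, y]) =
   (comonotonicity_copula (margin_df mu i x) (margin_df nu i y))%:E]
   (ex_intro _ (distribution P Z : probability _ _) ZP).
apply: (quadrant_measure_unique (m2 := distribution P Z)) => // -[x y].
by rewrite /quadrant/= ZP; exact: M.
Qed.

Lemma comonotone_integralE p i :
  (\int[comonotone_measure (margin_df mu i) (margin_df nu i)]_z
     (`|z.1 - z.2| `^ p)%:E =
   \int[P]_t (`|tnth (X t) i - tnth (Y t) i| `^ p)%:E)%E.
Proof.
pose Z : {mfun R >-> (R * R)%type} :=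
  mfun_Sub (mem_set (measurable_fun_pair (mXi i) (mYi i))).
rewrite (eq_measure_integral (distribution P Z)); last first.
  by move=> A mA _; exact: comonotone_measureE.
rewrite ge0_integral_distribution//.
apply/measurable_EFinP; apply: (measurableT_comp (measurable_powR p)).
by apply: measurableT_comp => //; exact: measurable_funB.
Qed.

Lemma comonotone_cost_le_coupling p pi : 1 <= p -> coupling mu nu pi ->
  (comonotone_cost p mu nu <=
   \sum_(i < d) \int[pi]_z (`|tnth z.1 i - tnth z.2 i| `^ p)%:E)%E.
Proof.
move=> p1 pimn; apply: lee_sum => i _; rewrite comonotone_integralE.
have mt1 : measurable_fun setT (fun z : d.-tuple R * d.-tuple R => tnth z.1 i).
  exact: (measurableT_comp (measurable_tnth i)).
have mt2 : measurable_fun setT (fun z : d.-tuple R * d.-tuple R => tnth z.2 i).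
  exact: (measurableT_comp (measurable_tnth i)).
apply: comonotone_optimal => //.
- move=> A mA; pose B := (fun z : d.-tuple R => tnth z i) @^-1` A.
  have mB : measurable B by rewrite /B -[_ @^-1` _]setTI; exact: measurable_tnth.
  rewrite (_ : _ @^-1` A = X @^-1` B)// quantile_vector_distribution//.
  have [<- _] := pimn B mB; congr (pi _); apply/seteqP; by split=> z // [].
- move=> A mA; pose B := (fun z : d.-tuple R => tnth z i) @^-1` A.
  have mB : measurable B by rewrite /B -[_ @^-1` _]setTI; exact: measurable_tnth.
  rewrite (_ : _ @^-1` A = Y @^-1` B)// quantile_vector_distribution//.
  have [_ <-] := pimn B mB; congr (pi _); apply/seteqP; by split=> z // [].
- move=> D E dD dE.
  (* Both quantile transforms are nondecreasing in [V_i]. A [t] violating the first inclusion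
     therefore lies, in terms of [V_i], above every [s] with [Y_i(s)] in [E], which puts [X_i(s)] in
     [D]. *)
  have [|/existsNP[t /not_implyP[Dt Et]]] := pselect
    (forall t, D (tnth (X t) i) -> E (tnth (Y t) i)); first by left.
  right=> s /= Es; have [st|ts] := leP (tnth (V s) i) (tnth (V t) i).
    exact: dD (quantile_vector_homo mu V01 st) Dt.
  by case: Et; exact: dE (quantile_vector_homo nu V01 (ltW ts)) Es.
Qed.

Let XY : {mfun R >-> (d.-tuple R * d.-tuple R)%type} :=
  mfun_Sub (mem_set (measurable_fun_pair mX mY)).

Lemma copula_coupling : coupling mu nu (distribution P XY).
Proof.
move=> A mA; rewrite /distribution /pushforward; split.
- rewrite -(quantile_vector_distribution muC mA); congr (P _).
  by apply/seteqP; split=> t // [].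
- rewrite -(quantile_vector_distribution nuC mA); congr (P _).
  by apply/seteqP; split=> t // [].
Qed.

Lemma copula_coupling_cost p :
  (\sum_(i < d) \int[distribution P XY]_z (`|tnth z.1 i - tnth z.2 i| `^ p)%:E =
   comonotone_cost p mu nu)%E.
Proof.
apply: eq_bigr => i _; rewrite comonotone_integralE ge0_integral_distribution//.
apply/measurable_EFinP; apply: (measurableT_comp (measurable_powR p)).
apply: measurableT_comp => //; apply: measurable_funB;
  exact: (measurableT_comp (measurable_tnth i)).
Qed.

End Coupling.

End CopulaCoupling.

(** One vector [V] serves all coordinates at once, so a single coupling attains the sum of the
    one-dimensional minima. *)
Lemma share_copula_optimal {R : realType} {d : nat} (p : R)
    (mu nu : probability (d.-tuple R) R) :
  (0 < d)%N -> 1 <= p -> share_copula mu nu ->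
  (forall pi, coupling mu nu pi -> (comonotone_cost p mu nu <=
     \sum_(i < d) \int[pi]_z (`|tnth z.1 i - tnth z.2 i| `^ p)%:E)%E) /\
  (exists2 pi, coupling mu nu pi &
    (\sum_(i < d) \int[pi]_z (`|tnth z.1 i - tnth z.2 i| `^ p)%:E =
     comonotone_cost p mu nu)%E).
Proof.
move=> d0 p1 [C [cC muC nuC]].
have [P P_uniform] := exists_uniform_probability R.
have [V [mV V01 PV]] := copula_vector d0 P_uniform cC.
split; first by move=> pi; exact: (comonotone_cost_le_coupling cC mV V01 PV).
eexists; first exact: (copula_coupling mV V01 PV muC nuC).
exact: (copula_coupling_cost cC).
Qed.

(** * From pointwise norm comparisons to bounds on the Wasserstein distance *)

Section WassersteinBounds.
Context {R : realType} {d : nat} (p q : R) (mu nu : probability (d.-tuple R) R).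
Hypotheses (d_gt0 : (0 < d)%N) (p_ge1 : 1 <= p).
Hypothesis mu_nu_copula : share_copula mu nu.

Lemma measurable_lnorm_powR : measurable_fun setT
  (fun z : d.-tuple R * d.-tuple R => lnorm q (tuple_sub z.1 z.2) `^ p).
Proof.
apply: (measurableT_comp (measurable_powR p)).
apply: (measurableT_comp (measurable_powR q^-1)).
apply: measurable_sum => i.
apply: (measurableT_comp (measurable_powR q)).
apply: measurableT_comp => //.
under eq_fun do rewrite tnth_mktuple.
by apply: measurable_funB; exact: (measurableT_comp (measurable_tnth i)).
Qed.

Lemma measurable_coordinate_cost i : measurable_fun setT
  (fun z : d.-tuple R * d.-tuple R => `|tnth z.1 i - tnth z.2 i| `^ p).
Proof.
apply: (measurableT_comp (measurable_powR p)); apply: measurableT_comp => //.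
by apply: measurable_funB; exact: (measurableT_comp (measurable_tnth i)).
Qed.

Lemma integral_coordinate_cost (a : R) (pi : probability (d.-tuple R * d.-tuple R)%type R) :
  0 <= a ->
  (\int[pi]_z (a * \sum_(i < d) `|tnth (tuple_sub z.1 z.2) i| `^ p)%:E =
   a%:E * \sum_(i < d) \int[pi]_z (`|tnth z.1 i - tnth z.2 i| `^ p)%:E)%E.
Proof.
move=> a0; rewrite -ge0_integral_sum//; last first.
  by move=> i; apply/measurable_EFinP; exact: measurable_coordinate_cost.
rewrite -ge0_integralZl//; last first.
- by move=> z _; apply: sume_ge0 => i _; rewrite lee_fin powR_ge0.
- apply: emeasurable_sum => i.
  by apply/measurable_EFinP; exact: measurable_coordinate_cost.
apply: eq_integral => z _; rewrite EFinM sumEFin; congr (_ * _%:E)%E.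
by apply: eq_bigr => i _; rewrite tnth_mktuple.
Qed.

Lemma wasserstein_powR_bounds (a b : R) : 0 <= a -> 0 <= b ->
  (forall z : d.-tuple R, a * \sum_(i < d) `|tnth z i| `^ p <= lnorm q z `^ p) ->
  (forall z : d.-tuple R, lnorm q z `^ p <= b * \sum_(i < d) `|tnth z i| `^ p) ->
  (a%:E * comonotone_cost p mu nu <= wasserstein p q mu nu `^ p)%E /\
  (wasserstein p q mu nu `^ p <= b%:E * comonotone_cost p mu nu)%E.
Proof.
move=> a0 b0 alow bup; have p_gt0 : 0 < p by apply: lt_le_trans p_ge1.
have [cost_le [pi0 pi0mn pi0E]] := share_copula_optimal d_gt0 p_ge1 mu_nu_copula.
have mE c : measurable_fun setT (fun z : d.-tuple R * d.-tuple R =>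
    (c * \sum_(i < d) `|tnth (tuple_sub z.1 z.2) i| `^ p)%:E).
  apply/measurable_EFinP; apply: measurable_funM => //; apply: measurable_sum => i.
  under eq_fun do rewrite tnth_mktuple.
  exact: measurable_coordinate_cost.
have mL := measurable_lnorm_powR.
have sum_ge0 (z : d.-tuple R) : 0 <= \sum_(i < d) `|tnth z i| `^ p.
  by apply: sumr_ge0 => i _; exact: powR_ge0.
rewrite /wasserstein; set I := ereal_inf _.
have I_ge0 : (0 <= I)%E.
  apply/ereal_infP => _ [pi _ <-].
  by apply: integral_ge0 => z _; rewrite lee_fin powR_ge0.
(* The p-th power undoes the root in [wasserstein] and leaves the infimum. The lower bound is
   checked on every coupling, the upper bound on the optimal one [pi0]. *)
rewrite -poweRrM mulVf ?gt_eqF// poweRe1//; split.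
  apply/ereal_infP => _ [pi pimn <-].
  apply: (@le_trans _ _
    (\int[pi]_z (a * \sum_(i < d) `|tnth (tuple_sub z.1 z.2) i| `^ p)%:E)%E).
    by rewrite integral_coordinate_cost// lee_wpmul2l ?lee_fin//; exact: cost_le.
  apply: ge0_le_integral => //.
  - by move=> z _; rewrite lee_fin mulr_ge0.
  - exact/measurable_EFinP.
  - by move=> z _; rewrite lee_fin.
apply: (@le_trans _ _ (\int[pi0]_z (lnorm q (tuple_sub z.1 z.2) `^ p)%:E)%E).
  by apply: ereal_inf_lbound; exists pi0.
rewrite -pi0E -integral_coordinate_cost//; apply: ge0_le_integral => //.
- by move=> z _; rewrite lee_fin powR_ge0.
- exact/measurable_EFinP.
- by move=> z _; rewrite lee_fin.
Qed.

End WassersteinBounds.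

Theorem proposition3p10 (R : realType) (d : nat) (p q : R)
    (mu nu : probability (d.-tuple R) R)
    (d_gt0 : (0 < d)%N) (p_ge1 : 1 <= p) (q_ge1 : 1 <= q) (q_neq_p : q <> p)
    (mu_moment : finite_moment p mu) (nu_moment : finite_moment p nu)
    (mu_nu_copula : share_copula mu nu) :
  (q <= p ->
    (comonotone_cost p mu nu <= wasserstein p q mu nu `^ p)%E /\
    (wasserstein p q mu nu `^ p <=
       (d%:R `^ (p / q - 1))%:E * comonotone_cost p mu nu)%E) /\
  (p <= q ->
    ((d%:R `^ (p / q - 1))%:E * comonotone_cost p mu nu <=
       wasserstein p q mu nu `^ p)%E /\
    (wasserstein p q mu nu `^ p <= comonotone_cost p mu nu)%E).
Proof.
have p_gt0 : 0 < p by apply: lt_le_trans p_ge1.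
have q_gt0 : 0 < q by apply: lt_le_trans q_ge1.
split=> [qp|pq].
(* The constants [a] and [b] are 1 and [d^(p/q - 1)] here, and are exchanged in the other case. *)
- rewrite -{1}[comonotone_cost p mu nu]mul1e.
  apply: wasserstein_powR_bounds; rewrite ?powR_ge0 ?ler01//.
  + by move=> z; rewrite mul1r; have [] := lnorm_powR_bounds_ge z d_gt0 q_gt0 qp.
  + by move=> z; have [] := lnorm_powR_bounds_ge z d_gt0 q_gt0 qp.
- rewrite -{2}[comonotone_cost p mu nu]mul1e.
  apply: wasserstein_powR_bounds; rewrite ?powR_ge0 ?ler01//.
  + by move=> z; have [] := lnorm_powR_bounds_le z d_gt0 p_gt0 pq.
  + by move=> z; rewrite mul1r; have [] := lnorm_powR_bounds_le z d_gt0 p_gt0 pq.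
Qed.
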